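(* Let $A\in\mathbb{R}^{n\times n}$ and $C_i\in\mathbb{R}^{s_i\times n}$, $i\in\mathbf{m}=\{1,\dots,m\}$, $m>1$, and suppose the system $\dot x=Ax$, $y_i=C_ix$ is jointly observable. Let $\mathcal{P}$ be a finite index set and, for each $p\in\mathcal{P}$, let $\mathbb{N}(p)$ be a strongly connected directed graph on the vertex set $\mathbf{m}$ with a self-loop at each vertex. Let $\tau_D>0$ and $\lambda>0$ be given. Then there exist matrices $K_i\in\mathbb{R}^{n\times s_i}$, $i\in\mathbf{m}$, and a number $g_0>0$ such that for every $g\ge g_0$ there is a constant $c>0$ with the following property: for every switching signal $\sigma\in\mathcal{S}(\tau_D)$, every initial state $x(0)$ and every initial estimator states $x_i(0)$, the solutions of the system and of the distributed observer $$\dot{x}_i = (A+K_iC_i)x_i -K_iy_i -gP_i\Big(x_i-\frac{1}{m_i(\sigma(t))}\sum_{j\in\mathcal{N}_i(\sigma(t))} x_j\Big),\quad i\in\mathbf{m},$$ satisfy $\|e(t)\|\le c\,e^{-\lambda t}\|e(0)\|$ for all $t\ge0$, where $e=\mathrm{column}\{x_1-x,\dots,x_m-x\}$. In particular each $x_i(t)-x(t)$ converges to zero at least as fast as $e^{-\lambda t}$.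
   Context: Joint observability means the pair $(C,A)$ with $C=[C_1'\ \cdots\ C_m']'$ is observable, equivalently $\bigcap_{i}\mathcal{V}_i=0$, where $\mathcal{V}_i$ is the unobservable subspace of $(C_i,A)$ (the largest $A$-invariant subspace contained in $\ker C_i$). $P_i$ denotes the orthogonal projection onto $\mathcal{V}_i$. For $p\in\mathcal{P}$, $\mathcal{N}_i(p)$ is the set of $j$ such that there is an arc from $j$ to $i$ in $\mathbb{N}(p)$ (so $i\in\mathcal{N}_i(p)$), and $m_i(p)$ is the number of elements of $\mathcal{N}_i(p)$. A switching signal is a piecewise-constant, right-continuous map $\sigma:[0,\infty)\to\mathcal{P}$ with finitely many discontinuities on each bounded interval; $\mathcal{S}(\tau_D)$ is the set of switching signals whose consecutive discontinuity times $t_1<t_2<\cdots$ (with $t_0=0$) satisfy $t_{k+1}-t_k\ge\tau_D$ for all $k\ge0$ (dwell time $\tau_D$). $g>0$ is a scalar gain. *)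

(* Defs.v *)
(* real numbers, vectors as (nat -> R) read only on indices < dim. *)
From Stdlib Require Import Reals List.
Open Scope R_scope.

Fixpoint sumR (n : nat) (f : nat -> R) : R :=
  match n with O => 0 | S k => sumR k f + f k end.

Fixpoint cnt (n : nat) (b : nat -> bool) : nat :=
  match n with O => O | S k => (cnt k b + if b k then 1 else 0)%nat end.

Definition vec := nat -> R.
Definition mat := nat -> nat -> R.

Definition mv (cols : nat) (M : mat) (v : vec) : vec :=
  fun r => sumR cols (fun c => M r c * v c).

Definition vsub (u v : vec) : vec := fun k => u k - v k.
Definition dot (n : nat) (u v : vec) : R := sumR n (fun k => u k * v k).
Definition is_zero (n : nat) (v : vec) : Prop := forall k, (k < n)%nat -> v k = 0.

(* linear subspace of R^n (vectors compared on indices < n) *)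
Definition subspace (n : nat) (W : vec -> Prop) : Prop :=
  W (fun _ => 0) /\
  (forall u v, W u -> W v -> W (fun k => u k + v k)) /\
  (forall a u, W u -> W (fun k => a * u k)) /\
  (forall u v, (forall k, (k < n)%nat -> u k = v k) -> W u -> W v).

Definition A_invariant (n : nat) (A : mat) (W : vec -> Prop) : Prop :=
  forall v, W v -> W (mv n A v).

Definition in_kernel (n s : nat) (C : mat) (W : vec -> Prop) : Prop :=
  forall v, W v -> is_zero s (mv n C v).

(* unobservable subspace of (C,A): the largest A-invariant subspace in ker C,
   i.e. the union of all A-invariant subspaces contained in ker C *)
Definition unobs (n s : nat) (C A : mat) (v : vec) : Prop :=
  exists W, subspace n W /\ A_invariant n A W /\ in_kernel n s C W /\ W v.

(* joint observability: (C,A) with C = stack of the C_i (i < m) is observable,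
   i.e. its unobservable subspace (largest A-invariant subspace in
   ker C = intersection of the ker C_i) is zero *)
Definition jointly_observable (n m : nat) (s : nat -> nat) (C : nat -> mat) (A : mat)
  : Prop :=
  forall W, subspace n W -> A_invariant n A W ->
    (forall i, (i < m)%nat -> in_kernel n (s i) (C i) W) ->
    forall v, W v -> is_zero n v.

Definition is_orth_proj (n : nat) (V : vec -> Prop) (Pm : mat) : Prop :=
  forall v, V (mv n Pm v) /\ (forall w, V w -> dot n (vsub v (mv n Pm v)) w = 0).

(* directed paths in graph with arc relation adj (adj j i = arc from j to i)
   on vertex set {0..m-1} *)
Inductive reach (adj : nat -> nat -> bool) (m : nat) (i : nat) : nat -> Prop :=
| reach_refl : (i < m)%nat -> reach adj m i i
| reach_step : forall j k, reach adj m i j -> (k < m)%nat -> adj j k = true ->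
    reach adj m i k.

Definition strongly_connected (adj : nat -> nat -> bool) (m : nat) : Prop :=
  forall i j, (i < m)%nat -> (j < m)%nat -> reach adj m i j.

Definition self_loops (adj : nat -> nat -> bool) (m : nat) : Prop :=
  forall i, (i < m)%nat -> adj i i = true.

Definition dwell_signal {P : Type} (tauD : R) (sigma : R -> P) : Prop :=
  exists ts : nat -> R, ts O = 0 /\
    (forall k, ts (S k) - ts k >= tauD) /\
    (forall k t, ts k <= t < ts (S k) -> sigma t = sigma (ts k)).

Definition cont_nonneg (f : R -> R) : Prop :=
  forall t, 0 <= t -> forall eps, eps > 0 -> exists delta, delta > 0 /\
    forall u, 0 <= u -> Rabs (u - t) < delta -> Rabs (f u - f t) < eps.

Definition rderiv (f : R -> R) (t l : R) : Prop :=
  forall eps, eps > 0 -> exists delta, delta > 0 /\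
    forall h, 0 < h < delta -> Rabs ((f (t + h) - f t) / h - l) < eps.

Definition solves (n : nat) (x : R -> vec) (F : R -> vec -> vec) : Prop :=
  forall k, (k < n)%nat ->
    cont_nonneg (fun t => x t k) /\
    forall t, 0 <= t -> rderiv (fun u => x u k) t (F t (x t) k).

Definition err_norm (n m : nat) (xs : nat -> vec) (x : vec) : R :=
  sqrt (sumR m (fun i => sumR n (fun k => (xs i k - x k) ^ 2))).

Definition observer_rhs (n m : nat) (s : nat -> nat) (A : mat) (C K Pm : nat -> mat)
  (g : R) {P : Type} (arc : P -> nat -> nat -> bool) (p : P)
  (i : nat) (xs : nat -> vec) (y : vec) : vec :=
  let avg : vec := fun k =>
    / INR (cnt m (fun j => arc p j i)) *
      sumR m (fun j => if arc p j i then xs j k else 0) in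
  fun k =>
    mv n A (xs i) k
    + mv (s i) (K i) (mv n (C i) (xs i)) k
    - mv (s i) (K i) y k
    - g * mv n (Pm i) (vsub (xs i) avg) k.

(* Main.v *)
(** Write [V_i] for the unobservable subspace of [(C_i, A)] and [P_i] for the projection onto it.

    Gains.  For large [nu] the Lyapunov equation [A'Q + QA + nu Q = C_i'C_i] has a symmetric
    solution [Q >= 0] with kernel exactly [V_i].  Taking [K_i] with [Q K_i = - C_i'] makes
    [q_i(e) = e'Qe] decay at rate [nu] along [A + K_i C_i], and the consensus term, whose
    values lie in [V_i], does not affect [q_i].

    Consensus.  If [pi] is the stationary distribution of the averaging matrix of a strongly
    connected graph, [sum_i pi_i <w_i, w_i - avg_i w>] is half the Dirichlet form of [w]; by
    joint observability it is coercive on families with [w_i] in [V_i].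

    Hence [U_pi = sum_i pi_i |P_i e_i|^2 + kappa sum_i q_i(e_i)], with [kappa] chosen after
    [g], decays at any prescribed rate [2 mu] between switches once [g] is large.  A switch
    multiplies [U] by at most [b^2], where [b] depends only on the graphs, and the dwell time
    absorbs this factor when [mu] is large enough. *)
Require Import Defs.
From Stdlib Require Import Reals List Lra Lia Psatz FunctionalExtensionality.
From HB Require structures.
From mathcomp Require all_boot all_algebra Rstruct.
Open Scope R_scope.

(** No spectral argument and no integral of matrix exponentials is used. The Lyapunov equation is a
    linear system on the space of matrices, so uniqueness gives existence, and positivity of its
    solution comes from iterating a contraction. The form q_i is defined on all of R^n; it replaces
    an observer on the quotient by V_i, and no basis adapted to V_i is chosen.

    The constants must be fixed without a circle. The bound b on weights and coercivity involves the
    graphs and the V_i, but no gain. Then come mu (from b, lambda, tauD), the matrices K_i, Q_i with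
    their bound d (from mu), the threshold for g (from b, d, mu), and last kappa. That order is
    forced: the coupling feeds e_i - P_i e_i into the equation of P_i e_i with a coefficient
    proportional to g, and the weight of q_i has to dominate it. Since the q_i part of U is the same
    for all graphs, the switching factor stays free of g and kappa, which enter only c.

    Solutions are only required to have right derivatives, so decay rests on a monotonicity lemma
    for continuous functions with a one-sided derivative. *)

Module LinearAlgebra.
Import HB.structures all_boot all_algebra Rstruct.
Import GRing.Theory.
Local Open Scope ring_scope.
Set Implicit Arguments.
Unset Strict Implicit.
Local Delimit Scope R_scope with coqR.

(** * Inverses, null vectors and the Lyapunov operator, through MathComp matrices *)

Lemma sumRE n (f : nat -> R) : sumR n f = \sum_(i < n) f i.
Proof. by elim: n => [|n IH] /=; rewrite ?big_ord0 // big_ord_recr /= -IH. Qed.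

Definition to_mx n (M : mat) : 'M[R]_n := \matrix_(i, j) M i j.
Definition of_mx n (M : 'M[R]_n) : mat := fun i j =>
  match insub i, insub j with Some a, Some b => M a b | _, _ => 0 end.
Definition to_cv n (v : vec) : 'cV[R]_n := \col_i v i.
Definition of_cv n (v : 'cV[R]_n) : vec := fun i =>
  match insub i with Some a => v a 0 | _ => 0 end.

Lemma of_mxE n (M : 'M[R]_n) (i j : 'I_n) : of_mx M i j = M i j.
Proof. by rewrite /of_mx !valK. Qed.

Lemma of_cvE n (v : 'cV[R]_n) (i : 'I_n) : of_cv v i = v i 0.
Proof. by rewrite /of_cv !valK. Qed.

Lemma to_mxK n : cancel (@of_mx n) (@to_mx n).
Proof. by move=> M; apply/matrixP => i j; rewrite mxE of_mxE. Qed.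

Lemma mvE n (M : mat) v (i : 'I_n) : mv n M v i = (to_mx n M *m to_cv n v) i 0.
Proof. by rewrite /mv sumRE mxE; apply: eq_bigr => j _; rewrite !mxE. Qed.

Lemma to_cv_mv n (M : mat) v : to_cv n (mv n M v) = to_mx n M *m to_cv n v.
Proof. by apply/colP => i; rewrite mxE mvE. Qed.

Lemma singular n (M : mat) : to_mx n M \notin unitmx ->
  exists2 v : 'cV[R]_n, v != 0 & to_mx n M *m v = 0.
Proof.
rewrite unitmxE unitfE negbK -det_tr => /det0P[v v0 vM].
exists v^T; first by rewrite trmx_eq0.
by apply: trmx_inj; rewrite trmx_mul trmxK trmx0.
Qed.

Lemma inj_unitmx n (M : mat) :
  (forall v, (forall k, (k < n)%coq_nat -> mv n M v k = 0%coqR) ->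
             forall k, (k < n)%coq_nat -> v k = 0%coqR) -> to_mx n M \in unitmx.
Proof.
move=> inj; case: (boolP (to_mx n M \in unitmx)) => // /singular[v v0 Mv]; case/eqP: v0.
apply/colP => i; rewrite mxE -of_cvE; apply: inj; last exact/ltP.
move=> k /ltP kn; rewrite (mvE M (of_cv v) (Ordinal kn)).
suff ->: to_cv n (of_cv v) = v by rewrite Mv mxE.
by apply/colP => j; rewrite mxE of_cvE.
Qed.

Lemma injective_inverse n (M : mat) :
  (forall v, (forall k, (k < n)%coq_nat -> mv n M v k = 0%coqR) ->
             forall k, (k < n)%coq_nat -> v k = 0%coqR) ->
  exists L : mat, forall v k, (k < n)%coq_nat ->
    mv n L (mv n M v) k = v k /\ mv n M (mv n L v) k = v k.
Proof.
move=> /inj_unitmx uM; exists (of_mx (invmx (to_mx n M))) => v k /ltP kn.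
rewrite (mvE _ _ (Ordinal kn)) (mvE _ _ (Ordinal kn)) !to_cv_mv to_mxK.
by rewrite mulKmx // mulKVmx // mxE.
Qed.

(** A square matrix with a right null vector is singular, hence has a left one. For the averaging
    matrix minus the identity the right null vector is the constant 1, and the left one leads to the
    stationary weights. *)
Lemma left_null_vector n (M : mat) (v : vec) k0 :
  (k0 < n)%coq_nat -> v k0 <> 0%coqR -> (forall k, (k < n)%coq_nat -> mv n M v k = 0%coqR) ->
  exists u : vec, (exists k, (k < n)%coq_nat /\ u k <> 0%coqR) /\
    forall j, (j < n)%coq_nat -> sumR n (fun i => u i * M i j)%coqR = 0%coqR.
Proof.
move=> /ltP k0n vk0 Mv.
have: \det (to_mx n M) == 0.
  apply/negPn/negP => dM; have uM: to_mx n M \in unitmx by rewrite unitmxE unitfE dM.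
  case: vk0; have: to_cv n v = 0.
    rewrite -[to_cv n v](mulKmx uM); suff ->: to_mx n M *m to_cv n v = 0 by rewrite mulmx0.
    by apply/colP => i; rewrite -mvE Mv ?mxE //; apply/ltP.
  by move/colP/(_ (Ordinal k0n)); rewrite !mxE.
case/det0P => u u0 uM; exists (of_cv u^T); split.
  case/rV0Pn: u0 => i ui; exists i; split; first exact/ltP.
  by rewrite of_cvE mxE; apply/eqP.
move=> j /ltP jn; move/rowP/(_ (Ordinal jn)): uM; rewrite !mxE => uMj.
apply: etrans uMj; rewrite sumRE; apply: eq_bigr => i _; by rewrite of_cvE !mxE.
Qed.

(** An injective linear operator on the finite-dimensional space of n by n matrices is onto.
    [lin_mx] represents [Q -> A'Q + QA + nu Q] as a matrix acting on vectorised [Q], so that the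
    determinant criterion applies. *)
Lemma lyapunov_solvable n (A S : mat) (nu : R) :
  let L (Q : mat) i j := (sumR n (fun k => A k i * Q k j) +
     sumR n (fun k => Q i k * A k j) + nu * Q i j)%coqR in
  (forall Q, (forall i j, (i < n)%coq_nat -> (j < n)%coq_nat -> L Q i j = 0%coqR) ->
    forall i j, (i < n)%coq_nat -> (j < n)%coq_nat -> Q i j = 0%coqR) ->
  exists Q, forall i j, (i < n)%coq_nat -> (j < n)%coq_nat -> L Q i j = S i j.
Proof.
move=> L inj; pose a := to_mx n A.
pose f (Q : 'M[R]_n) : 'M[R]_n := a^T *m Q + Q *m a + nu *: Q.
have fE (Q : 'M[R]_n) (i j : 'I_n) : L (of_mx Q) i j = f Q i j.
  rewrite /L !sumRE !mxE !of_mxE; congr (_ + _ + _).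
    by apply: eq_bigr => k _; rewrite !mxE of_mxE.
  by apply: eq_bigr => k _; rewrite !mxE of_mxE.
have flin : linear f.
  move=> c u v; rewrite /f !mulmxDr !mulmxDl !scalerDr -!scalemxAr -!scalemxAl.
  rewrite !scalerA [nu * c]mulrC; do !rewrite -!addrA; congr (_ + _).
  rewrite [LHS]addrCA; congr (_ + _); rewrite addrCA [in RHS]addrCA.
  by rewrite [RHS]addrCA; congr (_ + _); rewrite [RHS]addrCA.
pose F : {linear 'M[R]_n -> 'M[R]_n} :=
  HB.pack f (GRing.isLinear.Build _ _ _ _ f flin).
have uF : lin_mx F \in unitmx.
  case: (boolP (lin_mx F \in unitmx)) => //.
  rewrite unitmxE unitfE negbK => /det0P[q q0 qF]; case/eqP: q0.
  have fq : f (vec_mx q) = 0.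
    by apply: (can_inj mxvecK); rewrite -[f]/(F : _ -> _) -mul_vec_lin vec_mxK qF linear0.
  rewrite -[q]vec_mxK (_ : vec_mx q = 0) ?linear0 //.
  apply/matrixP => i j; rewrite -of_mxE mxE; apply: inj; try exact/ltP.
  move=> k l /ltP kn /ltP ln.
  by rewrite (fE _ (Ordinal kn) (Ordinal ln)) fq mxE.
exists (of_mx (vec_mx (mxvec (to_mx n S) *m invmx (lin_mx F)))) => i j /ltP ni /ltP nj.
rewrite (fE _ (Ordinal ni) (Ordinal nj)).
set q := _ *m _; suff -> : f (vec_mx q) = to_mx n S by rewrite mxE.
by apply: (can_inj mxvecK); rewrite -[f]/(F : _ -> _) -mul_vec_lin vec_mxK mulmxKV.
Qed.

End LinearAlgebra.

(** * Sums, dot products and matrices *)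

Lemma sumR_ext n f g : (forall k, (k < n)%nat -> f k = g k) -> sumR n f = sumR n g.
Proof.
  induction n as [|n IH]; simpl; intros H; [reflexivity|].
  rewrite IH, H; auto.
Qed.

Lemma sumR_plus n f g : sumR n (fun k => f k + g k) = sumR n f + sumR n g.
Proof. induction n as [|n IH]; simpl; [|rewrite IH]; ring. Qed.

Lemma sumR_minus n f g : sumR n (fun k => f k - g k) = sumR n f - sumR n g.
Proof. induction n as [|n IH]; simpl; [|rewrite IH]; ring. Qed.

Lemma sumR_scal n a f : sumR n (fun k => a * f k) = a * sumR n f.
Proof. induction n as [|n IH]; simpl; [|rewrite IH]; ring. Qed.

Lemma sumR_scal_r n a f : sumR n (fun k => f k * a) = sumR n f * a.
Proof. induction n as [|n IH]; simpl; [|rewrite IH]; ring. Qed.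

Lemma sumR_zero n f : (forall k, (k < n)%nat -> f k = 0) -> sumR n f = 0.
Proof.
  induction n as [|n IH]; simpl; intros H; [reflexivity|].
  rewrite IH, H; auto; ring.
Qed.

Lemma sumR_const n a : sumR n (fun _ => a) = INR n * a.
Proof. induction n as [|n IH]; [simpl; ring|]. rewrite S_INR; simpl; rewrite IH; ring. Qed.

Lemma sumR_le n f g : (forall k, (k < n)%nat -> f k <= g k) -> sumR n f <= sumR n g.
Proof.
  induction n as [|n IH]; simpl; intros H; [lra|].
  specialize (IH (fun k Hk => H k (Nat.lt_lt_succ_r _ _ Hk))).
  specialize (H n (Nat.lt_succ_diag_r n)). lra.
Qed.

Lemma sumR_nonneg n f : (forall k, (k < n)%nat -> 0 <= f k) -> 0 <= sumR n f.
Proof. intros H. rewrite <- (sumR_zero n (fun _ => 0)) by auto. now apply sumR_le. Qed.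

Lemma sumR_term_le n f k :
  (forall j, (j < n)%nat -> 0 <= f j) -> (k < n)%nat -> f k <= sumR n f.
Proof.
  induction n as [|n IH]; simpl; intros H Hk; [lia|].
  assert (Hn : 0 <= sumR n f) by (apply sumR_nonneg; auto).
  assert (Hf : 0 <= f n) by auto.
  destruct (Nat.eq_dec k n) as [->|]; [lra|].
  assert (f k <= sumR n f) by (apply IH; auto; lia). lra.
Qed.

Lemma sumR_nonneg_zero n f :
  (forall k, (k < n)%nat -> 0 <= f k) -> sumR n f = 0 ->
  forall k, (k < n)%nat -> f k = 0.
Proof.
  intros H H0 k Hk. pose proof (sumR_term_le n f k H Hk). pose proof (H k Hk). lra.
Qed.

Lemma sumR_swap n m f :
  sumR n (fun i => sumR m (fun j => f i j)) = sumR m (fun j => sumR n (fun i => f i j)).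
Proof.
  induction n as [|n IH]; simpl.
  - symmetry; now apply sumR_zero.
  - now rewrite IH, <- sumR_plus.
Qed.

Lemma sumR_Rabs n f : Rabs (sumR n f) <= sumR n (fun k => Rabs (f k)).
Proof.
  induction n as [|n IH]; simpl; [rewrite Rabs_R0; lra|].
  pose proof (Rabs_triang (sumR n f) (f n)). lra.
Qed.

Lemma sumR_delta n i f :
  (i < n)%nat -> sumR n (fun j => (if Nat.eqb i j then 1 else 0) * f j) = f i.
Proof.
  induction n as [|n IH]; simpl; intros Hi; [lia|].
  destruct (Nat.eq_dec i n) as [->|Hne].
  - rewrite Nat.eqb_refl, sumR_zero; [ring|].
    intros k Hk. replace (Nat.eqb n k) with false; [ring|].
    symmetry; apply Nat.eqb_neq; lia.
  - rewrite IH by lia. replace (Nat.eqb i n) with false; [ring|].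
    symmetry; now apply Nat.eqb_neq.
Qed.

(** Cauchy-Schwarz against the constant vector 1. *)
Lemma sumR_sqr_le n f : (sumR n f) ^ 2 <= INR n * sumR n (fun k => f k ^ 2).
Proof.
  induction n as [|n IH]; [simpl; lra|].
  rewrite S_INR; cbn [sumR].
  set (b := f n).
  remember (sumR n f) as a eqn:Ea; clear Ea.
  assert (0 <= INR n) by apply pos_INR.
  assert (Hq : 0 <= sumR n (fun k => f k ^ 2)) by (apply sumR_nonneg; intros; apply pow2_ge_0).
  remember (sumR n (fun k => f k ^ 2)) as q eqn:Eq; clear Eq.
  assert (2 * a * b <= q + INR n * b ^ 2).
  (* For n = 0 the factor n cannot be cancelled; there the induction hypothesis forces a = 0. *)
  { destruct (Req_dec (INR n) 0) as [E|E].
    - rewrite E in *. assert (Ha : a = 0) by (apply Rsqr_0_uniq, Rle_antisym; [rewrite Rsqr_pow2; lra|apply Rle_0_sqr]). rewrite Ha. lra.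
    - assert (0 < INR n) by lra.
      apply Rmult_le_reg_l with (INR n); [lra|].
      pose proof (pow2_ge_0 (a - INR n * b)). nra. }
  nra.
Qed.

Definition vadd (u v : vec) : vec := fun k => u k + v k.
Definition vscal (a : R) (u : vec) : vec := fun k => a * u k.
Notation nsq n v := (dot n v v).

Lemma dot_comm n u v : dot n u v = dot n v u.
Proof. apply sumR_ext; intros; ring. Qed.

Lemma dot_vadd_l n u v w : dot n (vadd u v) w = dot n u w + dot n v w.
Proof. unfold dot, vadd. rewrite <- sumR_plus. apply sumR_ext; intros; ring. Qed.

Lemma dot_vscal_l n a u w : dot n (vscal a u) w = a * dot n u w.
Proof. unfold dot, vscal. rewrite <- sumR_scal. apply sumR_ext; intros; ring. Qed.

Lemma dot_vsub_l n u v w : dot n (vsub u v) w = dot n u w - dot n v w.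
Proof. unfold dot, vsub. rewrite <- sumR_minus. apply sumR_ext; intros; ring. Qed.

Lemma dot_vadd_r n u v w : dot n w (vadd u v) = dot n w u + dot n w v.
Proof. rewrite !(dot_comm n w). apply dot_vadd_l. Qed.

Lemma dot_vscal_r n a u w : dot n w (vscal a u) = a * dot n w u.
Proof. rewrite !(dot_comm n w). apply dot_vscal_l. Qed.

Lemma dot_vsub_r n u v w : dot n w (vsub u v) = dot n w u - dot n w v.
Proof. rewrite !(dot_comm n w). apply dot_vsub_l. Qed.

Lemma mv_vadd n M u v : mv n M (vadd u v) = vadd (mv n M u) (mv n M v).
Proof.
  extensionality r. unfold mv, vadd. rewrite <- sumR_plus. apply sumR_ext; intros; ring.
Qed.

Lemma mv_vsub n M u v : mv n M (vsub u v) = vsub (mv n M u) (mv n M v).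
Proof.
  extensionality r. unfold mv, vsub. rewrite <- sumR_minus. apply sumR_ext; intros; ring.
Qed.

Lemma mv_vscal n M a u : mv n M (vscal a u) = vscal a (mv n M u).
Proof.
  extensionality r. unfold mv, vscal. rewrite <- sumR_scal. apply sumR_ext; intros; ring.
Qed.

Ltac vlin := rewrite ?mv_vadd, ?mv_vsub, ?mv_vscal;
  repeat first [rewrite dot_vadd_l | rewrite dot_vadd_r | rewrite dot_vsub_l
    | rewrite dot_vsub_r | rewrite dot_vscal_l | rewrite dot_vscal_r].

Lemma mv_ext n M u v : (forall k, (k < n)%nat -> u k = v k) -> mv n M u = mv n M v.
Proof.
  intros H. extensionality r. apply sumR_ext; intros k Hk. now rewrite H.
Qed.

Lemma dot_ext n u u' v v' :
  (forall k, (k < n)%nat -> u k = u' k) -> (forall k, (k < n)%nat -> v k = v' k) ->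
  dot n u v = dot n u' v'.
Proof. intros H H'. apply sumR_ext; intros k Hk. now rewrite H, H'. Qed.

Lemma dot_zero_l n u v : is_zero n u -> dot n u v = 0.
Proof. intros H. apply sumR_zero; intros k Hk. rewrite H by auto. ring. Qed.

Lemma nsq_nonneg n v : 0 <= nsq n v.
Proof. apply sumR_nonneg; intros; nra. Qed.

Lemma nsq_zero n v : nsq n v = 0 -> is_zero n v.
Proof.
  intros H k Hk.
  pose proof (sumR_nonneg_zero n (fun k => v k * v k) (fun k _ => Rle_0_sqr (v k)) H k Hk).
  simpl in H0. nra.
Qed.

Lemma sqr_le_nsq n v k : (k < n)%nat -> v k ^ 2 <= nsq n v.
Proof.
  intros Hk. replace (v k ^ 2) with (v k * v k) by ring.
  apply (sumR_term_le n (fun k => v k * v k)); auto. intros; nra.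
Qed.

(** Young's inequality, from |a u - v|^2 >= 0. The free parameter decides which side of a cross term
    is kept small. *)
Lemma dot_le n a u v : 0 < a -> 2 * dot n u v <= a * nsq n u + nsq n v / a.
Proof.
  intros Ha. pose proof (nsq_nonneg n (vsub (vscal a u) v)) as H.
  revert H. vlin. rewrite (dot_comm n v u). intros H.
  apply Rmult_le_reg_l with a; [lra|].
  replace (a * (a * nsq n u + nsq n v / a)) with (a * a * nsq n u + nsq n v) by (field; lra).
  lra.
Qed.

Lemma nsq_vadd_le n u v : nsq n (vadd u v) <= 2 * nsq n u + 2 * nsq n v.
Proof. vlin. rewrite (dot_comm n v u). pose proof (dot_le n 1 u v). lra. Qed.

Lemma nsq_vsub_le n u v : nsq n (vsub u v) <= 2 * nsq n u + 2 * nsq n v.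
Proof.
  pose proof (nsq_vadd_le n u (vscal (-1) v)) as H. revert H. vlin. lra.
Qed.

Definition vsum (m : nat) (a : nat -> vec) : vec := fun k => sumR m (fun i => a i k).

Lemma dot_vsum_l n m a v : dot n (vsum m a) v = sumR m (fun i => dot n (a i) v).
Proof.
  unfold dot, vsum. rewrite sumR_swap. apply sumR_ext; intros.
  now rewrite sumR_scal_r.
Qed.

Lemma nsq_vsum_le n m a : nsq n (vsum m a) <= INR m * sumR m (fun i => nsq n (a i)).
Proof.
  unfold dot. rewrite sumR_swap, <- sumR_scal. apply sumR_le; intros k Hk.
  unfold vsum. pose proof (sumR_sqr_le m (fun i => a i k)) as H.
  replace (sumR m (fun i => a i k * a i k)) with (sumR m (fun i => a i k ^ 2))
    by (apply sumR_ext; intros; ring). nra.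
Qed.

Definition trm (M : mat) : mat := fun i j => M j i.

Lemma dot_mv_trm r c M u v : dot r (mv c M u) v = dot c u (mv r (trm M) v).
Proof.
  unfold dot, mv, trm.
  rewrite (sumR_ext r _ (fun k => sumR c (fun j => M k j * u j * v k)))
    by (intros; now rewrite sumR_scal_r).
  rewrite sumR_swap. apply sumR_ext; intros j Hj.
  rewrite <- sumR_scal. apply sumR_ext; intros; ring.
Qed.

Lemma mv_bounded r c M : exists b, 0 < b /\ forall v, nsq r (mv c M v) <= b * nsq c v.
Proof.
  induction r as [|r [b [Hb IH]]].
  - exists 1. split; [lra|]. intros v. simpl. pose proof (nsq_nonneg c v). unfold dot at 1; simpl. lra.
  - set (d := INR c * sumR c (fun k => M r k ^ 2)).
    assert (0 <= d).
    { apply Rmult_le_pos; [apply pos_INR|]. apply sumR_nonneg; intros; apply pow2_ge_0. }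
    exists (b + d). split; [lra|]. intros v.
    unfold dot at 1; simpl. fold (dot r (mv c M v) (mv c M v)). specialize (IH v).
    assert (mv c M v r * mv c M v r <= d * nsq c v).
    { unfold mv. pose proof (sumR_sqr_le c (fun k => M r k * v k)).
      assert (sumR c (fun k => (M r k * v k) ^ 2) <= sumR c (fun k => M r k ^ 2) * nsq c v).
      { rewrite <- sumR_scal_r. apply sumR_le; intros k Hk.
        pose proof (sqr_le_nsq c v k Hk). pose proof (pow2_ge_0 (M r k)).
        replace ((M r k * v k) ^ 2) with (M r k ^ 2 * v k ^ 2) by ring.
        apply Rmult_le_compat_l; auto. }
      pose proof (pos_INR c). unfold d.
      apply Rle_trans with (INR c * sumR c (fun k => (M r k * v k) ^ 2)); [lra|].
      rewrite Rmult_assoc. apply Rmult_le_compat_l; auto. }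
    lra.
Qed.

Lemma mv_dot_bounded n M : exists b, 0 < b /\ forall v, Rabs (dot n (mv n M v) v) <= b * nsq n v.
Proof.
  destruct (mv_bounded n n M) as [b [Hb H]]. exists (b + 1). split; [lra|]. intros v.
  specialize (H v). pose proof (nsq_nonneg n v).
  pose proof (dot_le n 1 (mv n M v) v). pose proof (dot_le n 1 (vscal (-1) (mv n M v)) v) as H2.
  rewrite !dot_vscal_l, dot_vscal_r in H2. apply Rabs_le. split; nra.
Qed.

Lemma mv_plus_mat n M N v : mv n (fun i j => M i j + N i j) v = vadd (mv n M v) (mv n N v).
Proof.
  extensionality r. unfold mv, vadd. rewrite <- sumR_plus. apply sumR_ext; intros; ring.
Qed.

Lemma mv_scal_mat n a M v : mv n (fun i j => a * M i j) v = vscal a (mv n M v).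
Proof.
  extensionality r. unfold mv, vscal. rewrite <- sumR_scal. apply sumR_ext; intros; ring.
Qed.

Lemma mv_mul_mat n r M N v :
  mv n (fun i j => sumR r (fun k => M i k * N k j)) v = mv r M (mv n N v).
Proof.
  extensionality i. unfold mv.
  rewrite (sumR_ext n _ (fun j => sumR r (fun k => M i k * N k j * v j)))
    by (intros; now rewrite sumR_scal_r).
  rewrite sumR_swap. apply sumR_ext; intros k Hk.
  rewrite <- sumR_scal. apply sumR_ext; intros; ring.
Qed.

Definition idm : mat := fun i j => if Nat.eqb i j then 1 else 0.

Lemma mv_idm n v k : (k < n)%nat -> mv n idm v k = v k.
Proof. intros Hk. unfold mv, idm. now rewrite sumR_delta. Qed.

Lemma Rabs_le_between x b : Rabs x <= b -> - b <= x <= b.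
Proof.
  intros H. pose proof (Rle_abs x). pose proof (Rle_abs (- x)). rewrite Rabs_Ropp in H1. lra.
Qed.

(** * Unobservable subspaces and the Lyapunov equation *)

(** Closes the two iterations below, for uniqueness and for positivity, where each round improves a
    bound by a fixed factor. *)
Lemma le_geometric_nonpos rho c x :
  0 <= rho < 1 -> (forall k, x <= c * rho ^ k) -> x <= 0.
Proof.
  intros Hrho H. apply Rnot_lt_le; intros Hx.
  assert (Hc : 0 < Rabs c + 1) by (pose proof (Rabs_pos c); lra).
  destruct (pow_lt_1_zero rho) with (y := x / (Rabs c + 1)) as [N HN].
  - rewrite Rabs_pos_eq; lra.
  - now apply Rdiv_lt_0_compat.
  - specialize (HN N (le_n N)). specialize (H N).
    assert (Hp : 0 <= rho ^ N) by (apply pow_le; lra).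
    rewrite Rabs_pos_eq in HN by auto.
    assert (rho ^ N * (Rabs c + 1) < x).
    { apply Rmult_lt_reg_r with (/ (Rabs c + 1)); [now apply Rinv_0_lt_compat|].
      rewrite Rmult_assoc, Rinv_r by lra. unfold Rdiv in HN. lra. }
    pose proof (Rle_abs c). nra.
Qed.

Lemma iter_mv_vadd n A k u v :
  Nat.iter k (mv n A) (vadd u v) = vadd (Nat.iter k (mv n A) u) (Nat.iter k (mv n A) v).
Proof. induction k as [|k IH]; simpl; [reflexivity|]. now rewrite IH, mv_vadd. Qed.

Lemma iter_mv_vscal n A k a u :
  Nat.iter k (mv n A) (vscal a u) = vscal a (Nat.iter k (mv n A) u).
Proof. induction k as [|k IH]; simpl; [reflexivity|]. now rewrite IH, mv_vscal. Qed.

Lemma mv_0 n M : mv n M (fun _ => 0) = fun _ => 0.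
Proof. extensionality r. apply sumR_zero; intros; ring. Qed.

Lemma iter_mv_ext n C A k u v :
  (forall j, (j < n)%nat -> u j = v j) ->
  mv n C (Nat.iter k (mv n A) u) = mv n C (Nat.iter k (mv n A) v).
Proof.
  intros H. destruct k as [|k]; [now apply mv_ext|].
  rewrite !Nat.iter_succ_r, (mv_ext n A u v); auto.
Qed.

(** The kernel of all [C A^k] is itself an invariant subspace in ker C, and it contains every other.
    This pointwise form makes closure under sums immediate, whereas two vectors given by the
    definition may come with different witnesses [W]. *)
Lemma unobs_iff n s C A v :
  unobs n s C A v <-> forall k, is_zero s (mv n C (Nat.iter k (mv n A) v)).
Proof.
  split.
  - intros [W [_ [HA [HC Hv]]]] k. apply HC. clear HC.
    induction k as [|k IH]; simpl; auto.
  - intros Hv. exists (fun v => forall k, is_zero s (mv n C (Nat.iter k (mv n A) v))).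
    repeat split; auto.
    + intros k. replace (Nat.iter k (mv n A) (fun _ => 0)) with (fun _ : nat => 0).
      * rewrite mv_0. intros ? ?; reflexivity.
      * induction k as [|k IH]; simpl; [reflexivity|]. now rewrite <- IH, mv_0.
    + intros u w Hu Hw k j Hj. change (fun k => u k + w k) with (vadd u w).
      rewrite iter_mv_vadd, mv_vadd. unfold vadd. rewrite Hu, Hw by auto. ring.
    + intros a u Hu k j Hj. change (fun k => a * u k) with (vscal a u).
      rewrite iter_mv_vscal, mv_vscal. unfold vscal. rewrite Hu by auto. ring.
    + intros u w E Hu k. rewrite <- (iter_mv_ext n C A k u w E). auto.
    + intros w Hw k. rewrite <- Nat.iter_succ_r. apply Hw.
    + intros w Hw. apply (Hw O).
Qed.

Lemma unobs_vadd n s C A u v :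
  unobs n s C A u -> unobs n s C A v -> unobs n s C A (vadd u v).
Proof.
  rewrite !unobs_iff. intros Hu Hv k j Hj.
  rewrite iter_mv_vadd, mv_vadd. unfold vadd. rewrite Hu, Hv by auto. ring.
Qed.

Lemma unobs_vscal n s C A a u : unobs n s C A u -> unobs n s C A (vscal a u).
Proof.
  rewrite !unobs_iff. intros Hu k j Hj.
  rewrite iter_mv_vscal, mv_vscal. unfold vscal. rewrite Hu by auto. ring.
Qed.

Lemma unobs_vsub n s C A u v :
  unobs n s C A u -> unobs n s C A v -> unobs n s C A (vsub u v).
Proof.
  intros Hu Hv. replace (vsub u v) with (vadd u (vscal (-1) v)).
  - apply unobs_vadd, unobs_vscal; auto.
  - extensionality k. unfold vadd, vscal, vsub. ring.
Qed.

Lemma unobs_ext n s C A u v :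
  (forall k, (k < n)%nat -> u k = v k) -> unobs n s C A u -> unobs n s C A v.
Proof.
  rewrite !unobs_iff. intros E Hu k. rewrite <- (iter_mv_ext n C A k u v E). auto.
Qed.

Lemma unobs_mv n s C A v : unobs n s C A v -> unobs n s C A (mv n A v).
Proof. rewrite !unobs_iff. intros Hv k. rewrite <- Nat.iter_succ_r. apply Hv. Qed.

Lemma unobs_ker n s C A v : unobs n s C A v -> is_zero s (mv n C v).
Proof. rewrite unobs_iff. intros Hv. apply (Hv O). Qed.

Section Projection.
Variables (n s : nat) (C A Pm : mat).
Hypothesis HP : is_orth_proj n (unobs n s C A) Pm.

Lemma proj_sym u v : dot n (mv n Pm u) v = dot n u (mv n Pm v).
Proof.
  destruct (HP u) as [Vu Ou]. destruct (HP v) as [Vv Ov].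
  specialize (Ou _ Vv). specialize (Ov _ Vu). rewrite dot_vsub_l in Ou, Ov.
  rewrite (dot_comm n (mv n Pm v)), (dot_comm n v) in Ov. lra.
Qed.

Lemma proj_fix w : unobs n s C A w -> forall k, (k < n)%nat -> mv n Pm w k = w k.
Proof.
  intros Hw k Hk. destruct (HP w) as [Vw Ow].
  specialize (Ow _ (unobs_vsub _ _ _ _ _ _ Hw Vw)).
  apply nsq_zero in Ow. specialize (Ow k Hk). unfold vsub in Ow. lra.
Qed.

Lemma proj_pythagoras v : nsq n v = nsq n (mv n Pm v) + nsq n (vsub v (mv n Pm v)).
Proof.
  destruct (HP v) as [Vv Ov]. specialize (Ov _ Vv). revert Ov. vlin.
  rewrite (dot_comm n (mv n Pm v) v). lra.
Qed.

Lemma proj_dist_le v w :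
  unobs n s C A w -> nsq n (vsub v (mv n Pm v)) <= nsq n (vsub v w).
Proof.
  intros Hw. destruct (HP v) as [Vv Ov].
  pose proof (Ov _ (unobs_vsub _ _ _ _ _ _ Vv Hw)) as E.
  pose proof (nsq_nonneg n (vsub (mv n Pm v) w)) as H. revert E H. vlin.
  rewrite (dot_comm n (mv n Pm v) v), (dot_comm n w v), (dot_comm n w (mv n Pm v)). lra.
Qed.
End Projection.

(* With [y = Q v], the equation at [u = y] bounds [|Q v|^2] by half the bound known for
   [Q], as [W] contains [A v]; iterating gives [Q v = 0]. *)
Lemma sylvester_zero n A Q a b nu (W : vec -> Prop) :
  (forall v, Rabs (dot n (mv n A v) v) <= a * nsq n v) ->
  0 < b -> (forall v, nsq n (mv n A v) <= b * nsq n v) -> a + b + 1 <= nu ->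
  (forall v, W v -> W (mv n A v)) ->
  (forall u v, W v -> dot n (mv n A u) (mv n Q v) + dot n u (mv n Q (mv n A v))
     + nu * dot n u (mv n Q v) = 0) ->
  forall v, W v -> is_zero n (mv n Q v).
Proof.
  intros Ha Hb0 Hb Hnu HW HQ.
  destruct (mv_bounded n n Q) as [B [HB0 HB]].
  assert (H : forall k v, W v -> nsq n (mv n Q v) <= B * (1/2) ^ k * nsq n v).
  { induction k as [|k IH]; intros v Hv; [simpl; rewrite Rmult_1_r; apply HB|].
    specialize (IH _ (HW _ Hv)). pose proof (HQ (mv n Q v) v Hv) as E.
    pose proof (Ha (mv n Q v)) as Ea. apply Rabs_le_between in Ea.
    pose proof (dot_le n 1 (vscal (-1) (mv n Q v)) (mv n Q (mv n A v))) as E1.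
    revert E1. vlin. intros E1. specialize (Hb v).
    pose proof (nsq_nonneg n (mv n Q v)). pose proof (nsq_nonneg n v).
    simpl pow. set (y := nsq n (mv n Q v)) in *.
    set (p := (1/2) ^ k) in *.
    assert (0 <= B * p) by (apply Rmult_le_pos; [lra|]; apply pow_le; lra).
    (* The assumption on [nu] leaves a coefficient of at least b in front of y; this b cancels the
       one from |A v|^2 <= b |v|^2, and the factor 1/2 is the gain of the round. *)
    assert (b * y <= 1/2 * (B * p * (b * nsq n v))) by nra.
    apply Rmult_le_reg_l with b; [lra|]. nra. }
  intros v Hv. apply nsq_zero, Rle_antisym; [|apply nsq_nonneg].
  apply (le_geometric_nonpos (1/2) (B * nsq n v)); [lra|].
  intros k. specialize (H k v Hv). lra.
Qed.

Lemma dot_lyapunov n A Q nu u v :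
  dot n u (mv n (fun i j => sumR n (fun k => A k i * Q k j) +
     sumR n (fun k => Q i k * A k j) + nu * Q i j) v) =
  dot n (mv n A u) (mv n Q v) + dot n u (mv n Q (mv n A v)) + nu * dot n u (mv n Q v).
Proof.
  rewrite !mv_plus_mat, mv_scal_mat, (mv_mul_mat n n (trm A) Q), (mv_mul_mat n n Q A).
  vlin. now rewrite dot_mv_trm.
Qed.

(** Uniqueness is [sylvester_zero] with no restriction on the vectors, and it yields a solution. The
    right-hand side is symmetric, so the transpose is a solution too, and the mean of the two is
    symmetric. *)
Lemma lyapunov_form n s A C a b nu :
  (forall v, Rabs (dot n (mv n A v) v) <= a * nsq n v) ->
  0 < b -> (forall v, nsq n (mv n A v) <= b * nsq n v) -> a + b + 1 <= nu ->
  exists Q, (forall u v, dot n (mv n Q u) v = dot n u (mv n Q v)) /\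
    forall u v, dot n (mv n A u) (mv n Q v) + dot n u (mv n Q (mv n A v))
     + nu * dot n u (mv n Q v) = dot s (mv n C u) (mv n C v).
Proof.
  intros Ha Hb0 Hb Hnu.
  destruct (@LinearAlgebra.lyapunov_solvable n A
    (fun i j => sumR s (fun k => C k i * C k j)) nu) as [Q HQ].
  - intros Q HQ i j Hi Hj.
    pose proof (sylvester_zero n A Q a b nu (fun _ => True) Ha Hb0 Hb Hnu
      (fun _ _ => I)) as H.
    specialize (H (fun u v _ => eq_trans (eq_sym (dot_lyapunov n A Q nu u v))
      (eq_trans (dot_comm n _ _) (dot_zero_l n _ _
        (fun i Hi => sumR_zero n _ (fun j Hj =>
           eq_trans (f_equal (fun x => x * v j) (HQ i j Hi Hj)) (Rmult_0_l _))))))).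
    (* Row j of [idm] is the j-th unit vector; testing on it reads off column j of [Q]. *)
    specialize (H (idm j) I i Hi).
    unfold mv, idm in H.
    rewrite (sumR_ext n _ (fun k => (if Nat.eqb j k then 1 else 0) * Q i k)) in H
      by (intros; ring).
    now rewrite sumR_delta in H.
  - assert (E : forall u v, dot n (mv n A u) (mv n Q v) + dot n u (mv n Q (mv n A v))
       + nu * dot n u (mv n Q v) = dot s (mv n C u) (mv n C v)).
    { intros u v. rewrite <- dot_lyapunov, (dot_mv_trm s n C).
      rewrite <- mv_mul_mat. apply dot_ext; [reflexivity|]. intros i Hi.
      apply sumR_ext; intros j Hj. now rewrite HQ. }
    exists (fun i j => /2 * (Q i j + trm Q i j)).
    assert (Eq : forall v, mv n (fun i j => /2 * (Q i j + trm Q i j)) v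
      = vscal (/2) (vadd (mv n Q v) (mv n (trm Q) v))).
    { intros v. now rewrite mv_scal_mat, mv_plus_mat. }
    split; intros u v; rewrite !Eq; vlin.
    + rewrite (dot_mv_trm n n Q u v), (dot_mv_trm n n (trm Q) u v).
      change (trm (trm Q)) with Q. ring.
    + rewrite <- !dot_mv_trm, (dot_comm n (mv n Q (mv n A u)) v),
        (dot_comm n (mv n Q u) v), (dot_comm n (mv n Q u) (mv n A v)).
      pose proof (E u v) as E1. pose proof (E v u) as E2.
      rewrite (dot_comm s (mv n C v)) in E2. lra.
Qed.

(** Cauchy-Schwarz for a semidefinite form: with q(v) = v'Qv, expand q(v - Qv/b) >= 0 and use q(Qv)
    <= b |Qv|^2. *)
Lemma psd_nsq_le n Q b :
  (forall u v, dot n (mv n Q u) v = dot n u (mv n Q v)) ->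
  (forall v, 0 <= dot n v (mv n Q v)) ->
  0 < b -> (forall v, dot n v (mv n Q v) <= b * nsq n v) ->
  forall v, nsq n (mv n Q v) <= b * dot n v (mv n Q v).
Proof.
  intros Hs Hp Hb0 Hb v. set (y := mv n Q v).
  pose proof (Hp (vsub v (vscal (/b) y))) as H. specialize (Hb y).
  rewrite mv_vsub, mv_vscal in H. fold y in H.
  rewrite dot_vsub_l, !dot_vsub_r, !dot_vscal_l, !dot_vscal_r in H.
  rewrite <- (Hs v y) in H. fold y in H.
  assert (/b * (/b * dot n y (mv n Q y)) <= /b * nsq n y).
  { apply Rmult_le_compat_l; [left; now apply Rinv_0_lt_compat|].
    apply Rmult_le_reg_l with b; [lra|]. rewrite <- Rmult_assoc, Rinv_r by lra. lra. }
  assert (Hf : /b * nsq n y <= dot n v y) by lra.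
  apply Rmult_le_compat_l with (r := b) in Hf; [|lra].
  rewrite <- Rmult_assoc, Rinv_r in Hf; lra.
Qed.

(* Cayley transform: for [v = (1 + M) u] and [w = (1 - M) u] with [M = A + nu/2], the
   Lyapunov equation gives [q(v) - q(w) = 2 |C u|^2 >= 0], while [|w|^2 <= rho |v|^2]. *)
Lemma lyapunov_psd n s A C Q a nu :
  (forall v, Rabs (dot n (mv n A v) v) <= a * nsq n v) -> 2 * a + 2 <= nu ->
  (forall u v, dot n (mv n Q u) v = dot n u (mv n Q v)) ->
  (forall u v, dot n (mv n A u) (mv n Q v) + dot n u (mv n Q (mv n A v))
     + nu * dot n u (mv n Q v) = dot s (mv n C u) (mv n C v)) ->
  forall v, 0 <= dot n v (mv n Q v).
Proof.
  intros Ha Hnu Hs HQ.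
  set (N := fun i j => A i j + (1 + nu / 2) * idm i j).
  assert (HN : forall u k, (k < n)%nat -> mv n N u k = vadd (mv n A u) (vscal (1 + nu/2) u) k).
  { intros u k Hk. unfold N. rewrite mv_plus_mat, mv_scal_mat.
    unfold vadd, vscal. now rewrite mv_idm. }
  destruct (@LinearAlgebra.injective_inverse n N) as [L HL].
  { intros u Hu. apply nsq_zero.
    assert (E : dot n (mv n N u) u = 0) by now apply dot_zero_l.
    rewrite (dot_ext n _ (vadd (mv n A u) (vscal (1 + nu/2) u)) _ u (HN u)) in E by auto.
    revert E. vlin. intros E. specialize (Ha u). apply Rabs_le_between in Ha.
    pose proof (nsq_nonneg n u). nra. }
  destruct (mv_bounded n n N) as [B [HB0 HB]].
  destruct (mv_dot_bounded n Q) as [c [Hc0 Hc]].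
  (* Here |v|^2 - |w|^2 = 4 <u, Mu> >= 4 |u|^2 because nu/2 >= a + 1, and |v|^2 <= B |u|^2. Writing
     B + 4 instead of B keeps [rho] nonnegative. *)
  set (rho := 1 - 4 / (B + 4)).
  assert (Hrho : 0 <= rho < 1).
  { assert (0 < 4 / (B + 4)) by (apply Rdiv_lt_0_compat; lra).
    assert (4 / (B + 4) <= 1).
    { apply Rmult_le_reg_r with (B + 4); [lra|]. unfold Rdiv.
      rewrite Rmult_assoc, Rinv_l by lra. lra. }
    unfold rho; lra. }
  (* A negative value of q would persist undiminished from v to w, to the next w and so on, while
     the norms shrink geometrically and |q| is at most c times the squared norm. *)
  assert (H : forall k v, - dot n v (mv n Q v) <= c * rho ^ k * nsq n v).
  { induction k as [|k IH]; intros v.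
    - simpl. specialize (Hc v). apply Rabs_le_between in Hc.
      rewrite (dot_comm n (mv n Q v)) in Hc. lra.
    - set (u := mv n L v).
      set (w := vsub (vscal (1 - nu/2) u) (mv n A u)).
      set (v' := vadd (mv n A u) (vscal (1 + nu/2) u)).
      assert (Ev : forall k, (k < n)%nat -> v k = v' k).
      { intros j Hj. unfold v'. rewrite <- HN by auto. symmetry. now apply HL. }
      assert (Enu : nsq n v' <= B * nsq n u).
      { rewrite <- (dot_ext n (mv n N u) v' (mv n N u) v'); auto. }
      rewrite (mv_ext n Q v v' Ev), (dot_ext n v v' _ _ Ev (fun _ _ => eq_refl)).
      rewrite (dot_ext n v v' v v' Ev Ev).
      specialize (IH w). specialize (Ha u). apply Rabs_le_between in Ha.
      pose proof (HQ u u) as E. pose proof (nsq_nonneg s (mv n C u)).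
      assert (E1 : - dot n v' (mv n Q v') <= - dot n w (mv n Q w)).
      { unfold v', w. vlin. rewrite <- (Hs (mv n A u) u), (dot_comm n (mv n Q (mv n A u)) u).
        rewrite <- (Hs (mv n A u) u), (dot_comm n (mv n Q (mv n A u)) u) in E. nra. }
      assert (E2 : nsq n w <= nsq n v' - 4 * nsq n u).
      { unfold v', w. vlin. rewrite (dot_comm n u (mv n A u)).
        pose proof (nsq_nonneg n u). nra. }
      assert (E3 : nsq n w <= rho * nsq n v').
      { assert (4 / (B + 4) * nsq n v' <= 4 * nsq n u).
        { apply Rmult_le_reg_l with (B + 4); [lra|].
          replace ((B + 4) * (4 / (B + 4) * nsq n v')) with (4 * nsq n v') by (field; lra).
          pose proof (nsq_nonneg n u). nra. }
        unfold rho. lra. }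
      assert (0 <= c * rho ^ k) by (apply Rmult_le_pos; [lra|]; apply pow_le; lra).
      apply Rmult_le_compat_l with (r := c * rho ^ k) in E3; auto.
      simpl pow. lra. }
  intros v. assert (- dot n v (mv n Q v) <= 0); [|lra].
  apply (le_geometric_nonpos rho (c * nsq n v)); auto.
  intros k. specialize (H k v). lra.
Qed.

Lemma injective_bounded_below n N :
  (forall v, is_zero n (mv n N v) -> is_zero n v) ->
  exists b, 0 < b /\ forall v, nsq n v <= b * nsq n (mv n N v).
Proof.
  intros H. destruct (@LinearAlgebra.injective_inverse n N H) as [L HL].
  destruct (mv_bounded n n L) as [b [Hb0 Hb]].
  exists b. split; auto. intros v. specialize (Hb (mv n N v)).
  rewrite (dot_ext n _ v _ v) in Hb; auto; intros k Hk; now apply HL.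
Qed.

(** [Q] is singular on V_i, so [K] is obtained by inverting Q + P. The image of C' is orthogonal to
    V_i; therefore (Q + P)K = -C' forces PK = 0 and QK = -C'. The Lyapunov equation then gives <Qv,
    (A + KC)v> = -(nu q(v) + |Cv|^2)/2. *)
Lemma observer_gain n s A C Pm mu :
  is_orth_proj n (unobs n s C A) Pm ->
  exists K Q : mat, exists alpha beta, 0 < alpha /\ 0 < beta /\
    (forall u v, dot n (mv n Q u) v = dot n u (mv n Q v)) /\
    (forall v, alpha * nsq n (vsub v (mv n Pm v)) <= dot n v (mv n Q v)) /\
    (forall v, dot n v (mv n Q v) <= beta * nsq n v) /\
    (forall v w, dot n (mv n Q v) (mv n Pm w) = 0) /\
    (forall v, dot n (mv n Q v) (vadd (mv n A v) (mv s K (mv n C v)))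
       <= - mu * dot n v (mv n Q v)).
Proof.
  intros HP.
  destruct (mv_dot_bounded n A) as [a [Ha0 Ha]].
  destruct (mv_bounded n n A) as [b [Hb0 Hb]].
  (* Large enough for three demands: [a + b + 1] for solvability and uniqueness, [2 * a + 2] for
     positivity, [2 * mu] for the decay rate. *)
  set (nu := 2 * Rabs mu + 2 * a + b + 2).
  pose proof (Rabs_pos mu) as Hmu. pose proof (Rle_abs mu) as Hmu'.
  destruct (lyapunov_form n s A C a b nu) as [Q [Hs HQ]]; auto; [unfold nu; lra|].
  assert (Hp : forall v, 0 <= dot n v (mv n Q v)).
  { apply (lyapunov_psd n s A C Q a nu); auto; unfold nu; lra. }
  destruct (mv_dot_bounded n Q) as [beta [Hbeta0 Hbeta']].
  assert (Hbeta : forall v, dot n v (mv n Q v) <= beta * nsq n v).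
  { intros v. specialize (Hbeta' v). apply Rabs_le_between in Hbeta'.
    rewrite (dot_comm n v). lra. }
  clear Hbeta'.
  pose proof (psd_nsq_le n Q beta Hs Hp Hbeta0 Hbeta) as Hcs.
  assert (HkerV : forall v, is_zero n (mv n Q v) -> unobs n s C A v).
  { intros v Hv. exists (fun v => is_zero n (mv n Q v)). repeat split; auto.
    - rewrite mv_0. intros ? ?; reflexivity.
    - intros u w Hu Hw k Hk. change (fun k => u k + w k) with (vadd u w).
      rewrite mv_vadd. unfold vadd. rewrite Hu, Hw by auto. ring.
    - intros c u Hu k Hk. change (fun k => c * u k) with (vscal c u).
      rewrite mv_vscal. unfold vscal. rewrite Hu by auto. ring.
    - intros u w E Hu. now rewrite <- (mv_ext n Q u w E).
    (* If Qu = 0, the equation at (u, u) gives Cu = 0; at (QAu, u) it then reduces to |QAu|^2 =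
       0. *)
    - intros u Hu. apply nsq_zero. set (y := mv n Q (mv n A u)).
      assert (E0 : forall x, dot n x (mv n Q u) = 0).
      { intros x. rewrite dot_comm. now apply dot_zero_l. }
      pose proof (HQ y u) as E. rewrite !E0 in E. fold y in E.
      pose proof (HQ u u) as E'. rewrite !E0, <- Hs in E'.
      rewrite (dot_zero_l n (mv n Q u)) in E' by auto.
      rewrite (dot_comm s), (dot_zero_l s (mv n C u)) in E; [lra|].
      apply nsq_zero. lra.
    - intros u Hu. apply nsq_zero. rewrite <- HQ, <- (Hs u (mv n A u)).
      rewrite !(dot_comm n _ (mv n Q u)), !(dot_zero_l n (mv n Q u)) by auto. ring. }
  (* Restricted to V_i, where Cv = 0, the equation is homogeneous, so the uniqueness argument
     applies there. *)
  assert (HVker : forall v, unobs n s C A v -> is_zero n (mv n Q v)).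
  { apply (sylvester_zero n A Q a b nu); auto; [unfold nu; lra|intros v; apply unobs_mv|].
    intros u v Hv. rewrite HQ, dot_comm. apply dot_zero_l. now apply (unobs_ker n s C A). }
  assert (HQP : forall v w, dot n (mv n Q v) (mv n Pm w) = 0).
  { intros v w. rewrite Hs, dot_comm. apply dot_zero_l, HVker, HP. }
  (* [Q] has kernel V_i and P is the identity on it, with QP = 0, so the sum is injective. *)
  set (N := fun i j => Q i j + Pm i j).
  assert (HN : forall v, mv n N v = vadd (mv n Q v) (mv n Pm v)) by apply mv_plus_mat.
  assert (HNinj : forall v, is_zero n (mv n N v) -> is_zero n v).
  { intros v Hv.
    assert (E : dot n (mv n N v) (mv n Pm v) = 0) by now apply dot_zero_l.
    rewrite HN, dot_vadd_l, HQP, Rplus_0_l in E. apply nsq_zero in E.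
    assert (HQv : is_zero n (mv n Q v)).
    { intros k Hk. specialize (Hv k Hk). rewrite HN in Hv. unfold vadd in Hv.
      rewrite E in Hv by auto. lra. }
    intros k Hk. rewrite <- (proj_fix n s C A Pm HP v); auto. }
  destruct (@LinearAlgebra.injective_inverse n N HNinj) as [L HL].
  destruct (injective_bounded_below n N HNinj) as [c [Hc0 Hc]].
  set (K := fun i j => sumR n (fun k => (-1) * L i k * trm C k j)).
  (* For z = v - Pv one has Pz = 0 and QPv = 0, so Nz = Qv. Hence |z|^2 <= c |Qv|^2 <= c beta
     q(v). *)
  exists K, Q, (/ (c * beta)), beta.
  assert (Hcb : 0 < c * beta) by now apply Rmult_lt_0_compat.
  split; [now apply Rinv_0_lt_compat|]. repeat (split; [now auto|]). split; [|split; [auto|split; [auto|]]].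
  - intros v. apply Rmult_le_reg_l with (c * beta); auto.
    rewrite <- Rmult_assoc, Rinv_r, Rmult_1_l by lra.
    set (z := vsub v (mv n Pm v)).
    assert (Ez : is_zero n (mv n Pm z)).
    { intros k Hk. unfold z. rewrite mv_vsub. unfold vsub.
      rewrite (proj_fix n s C A Pm HP (mv n Pm v)); auto; [ring|apply HP]. }
    assert (EQ : forall k, (k < n)%nat -> mv n N z k = mv n Q v k).
    { intros k Hk. rewrite HN. unfold vadd. rewrite Ez by auto. unfold z.
      rewrite mv_vsub. unfold vsub. rewrite (HVker (mv n Pm v)); auto; [ring|apply HP]. }
    specialize (Hc z). rewrite (dot_ext n _ _ _ _ EQ EQ) in Hc.
    specialize (Hcs v). nra.
  - intros v. set (y := mv n C v).
    assert (EK : mv s K y = vscal (-1) (mv n L (mv s (trm C) y))).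
    { unfold K. rewrite mv_mul_mat. rewrite <- (mv_scal_mat n (-1)). reflexivity. }
    assert (ENK : forall u, dot n (mv n N (mv s K y)) u = - dot s y (mv n C u)).
    { intros u. rewrite EK, mv_vscal, dot_vscal_l.
      rewrite (dot_ext n _ (mv s (trm C) y) _ u); auto; [|intros; now apply HL].
      rewrite dot_mv_trm. change (trm (trm C)) with C. ring. }
    assert (EPK : is_zero n (mv n Pm (mv s K y))).
    { apply nsq_zero. set (p := mv n Pm (mv s K y)).
      pose proof (ENK p) as E. rewrite HN, dot_vadd_l in E. fold p in E.
      pose proof (HQP (mv s K y) (mv s K y)) as E3. fold p in E3. rewrite E3 in E.
      rewrite (dot_comm s), (dot_zero_l s (mv n C p)) in E; [lra|].
      apply (unobs_ker n s C A). apply HP. }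
    rewrite dot_vadd_r.
    assert (E : dot n (mv n Q v) (mv s K y) = - nsq s y).
    { pose proof (ENK v) as E. rewrite HN, dot_vadd_l, (dot_zero_l n (mv n Pm _)) in E by auto.
      rewrite Hs, (dot_comm n v). fold y in E. lra. }
    pose proof (HQ v v) as E2. fold y in E2. rewrite E.
    rewrite <- (Hs v (mv n A v)), (dot_comm n (mv n A v)) in E2.
    pose proof (nsq_nonneg s y). specialize (Hp v).
    assert (2 * mu * dot n v (mv n Q v) <= nu * dot n v (mv n Q v)).
    { apply Rmult_le_compat_r; auto. unfold nu; lra. }
    lra.
Qed.

(** * Consensus on strongly connected graphs *)

Lemma INR_cnt m b : INR (cnt m b) = sumR m (fun j => if b j then 1 else 0).
Proof.
  induction m as [|m IH]; simpl; [reflexivity|].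
  rewrite plus_INR, IH. now destruct (b m).
Qed.

Lemma INR_cnt_ge_1 m b i : (i < m)%nat -> b i = true -> 1 <= INR (cnt m b).
Proof.
  intros Hi Hb. rewrite INR_cnt.
  pose proof (sumR_term_le m (fun j => if b j then 1 else 0) i) as H.
  simpl in H. rewrite Hb in H. apply H; auto.
  intros j _; destruct (b j); lra.
Qed.

Section Graph.
Variables (m : nat) (adj : nat -> nat -> bool).
Hypothesis Hloop : self_loops adj m.

(** Row-stochastic averaging matrix. Its indices are transposed with respect to [adj]: row i is
    supported on the sources of arcs into i. *)
Definition weight (i j : nat) : R :=
  / INR (cnt m (fun j => adj j i)) * (if adj j i then 1 else 0).

(** Spelled as in [observer_rhs], so that the two are convertible; estimates go through
    [avg_weight]. *)
Definition avg (i : nat) (w : nat -> vec) : vec := fun k =>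
  / INR (cnt m (fun j => adj j i)) * sumR m (fun j => if adj j i then w j k else 0).

Lemma weight_nonneg i j : (i < m)%nat -> 0 <= weight i j.
Proof.
  intros Hi. pose proof (INR_cnt_ge_1 m (fun j => adj j i) i Hi (Hloop i Hi)).
  apply Rmult_le_pos; [left; apply Rinv_0_lt_compat; lra|]. destruct (adj j i); lra.
Qed.

Lemma weight_pos i j : (i < m)%nat -> adj j i = true -> 0 < weight i j.
Proof.
  intros Hi Hj. pose proof (INR_cnt_ge_1 m (fun j => adj j i) i Hi (Hloop i Hi)).
  unfold weight. rewrite Hj, Rmult_1_r. apply Rinv_0_lt_compat; lra.
Qed.

Lemma weight_le_1 i j : (i < m)%nat -> weight i j <= 1.
Proof.
  intros Hi. pose proof (INR_cnt_ge_1 m (fun j => adj j i) i Hi (Hloop i Hi)) as H.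
  pose proof (Rinv_le_contravar 1 _ ltac:(lra) H) as H'. rewrite Rinv_1 in H'.
  assert (0 < / INR (cnt m (fun j => adj j i))) by (apply Rinv_0_lt_compat; lra).
  unfold weight. destruct (adj j i); lra.
Qed.

Lemma weight_sum i : (i < m)%nat -> sumR m (weight i) = 1.
Proof.
  intros Hi. pose proof (INR_cnt_ge_1 m (fun j => adj j i) i Hi (Hloop i Hi)).
  unfold weight. rewrite sumR_scal, <- INR_cnt. apply Rinv_l. lra.
Qed.

Lemma avg_weight i w : avg i w = vsum m (fun j => vscal (weight i j) (w j)).
Proof.
  extensionality k. unfold avg, vsum, vscal, weight. rewrite <- sumR_scal.
  apply sumR_ext; intros j Hj. destruct (adj j i); ring.
Qed.

Lemma avg_vadd i u w : avg i (fun j => vadd (u j) (w j)) = vadd (avg i u) (avg i w).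
Proof.
  rewrite !avg_weight. extensionality k. unfold vsum, vscal, vadd.
  rewrite <- sumR_plus. apply sumR_ext; intros; ring.
Qed.

Lemma nsq_avg_le n i w : (i < m)%nat ->
  nsq n (avg i w) <= INR m * sumR m (fun j => nsq n (w j)).
Proof.
  intros Hi. rewrite avg_weight.
  eapply Rle_trans; [apply nsq_vsum_le|]. apply Rmult_le_compat_l; [apply pos_INR|].
  apply sumR_le; intros j Hj. vlin.
  pose proof (weight_nonneg i j Hi). pose proof (weight_le_1 i j Hi).
  rewrite <- Rmult_assoc; rewrite <- (Rmult_1_l (nsq n (w j))) at 2.
  apply Rmult_le_compat_r; [apply nsq_nonneg|]. nra.
Qed.

Lemma reach_lt i j : reach adj m i j -> (i < m)%nat /\ (j < m)%nat.
Proof. induction 1; tauto. Qed.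

(* A left null vector [u] of [S - I] satisfies [|u| <= |u| S] entrywise; both sides have the
   same total because the rows of [S] sum to 1, so [|u|] is stationary. *)
Lemma stationary_weights : (0 < m)%nat -> strongly_connected adj m ->
  exists pi, (forall i, (i < m)%nat -> 0 < pi i) /\
    forall j, (j < m)%nat -> sumR m (fun i => pi i * weight i j) = pi j.
Proof.
  intros Hm Hsc.
  destruct (@LinearAlgebra.left_null_vector m (fun i j => weight i j - idm i j)
    (fun _ => 1) 0%nat) as [u [[i0 [Hi0 Hu0]] Hu]]; auto.
  { intros k Hk. unfold mv.
    rewrite (sumR_ext m _ (fun j => weight k j - (if Nat.eqb k j then 1 else 0) * 1))
      by (intros; unfold idm; ring).
    rewrite sumR_minus, weight_sum, (sumR_delta m k (fun _ => 1)) by auto. ring. }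
  assert (Hst : forall j, (j < m)%nat -> sumR m (fun i => u i * weight i j) = u j).
  { intros j Hj. specialize (Hu j Hj).
    rewrite (sumR_ext m _ (fun i => u i * weight i j - (if Nat.eqb j i then 1 else 0) * u i)) in Hu
      by (intros; unfold idm; rewrite Nat.eqb_sym; ring).
    rewrite sumR_minus, sumR_delta in Hu by auto. lra. }
  assert (Hle : forall j, (j < m)%nat ->
    0 <= sumR m (fun i => Rabs (u i) * weight i j) - Rabs (u j)).
  { intros j Hj.
    pose proof (sumR_Rabs m (fun i => u i * weight i j)) as H.
    cbv beta in H. rewrite Hst in H by auto.
    rewrite (sumR_ext m (fun k => Rabs (u k * weight k j))
      (fun i => Rabs (u i) * weight i j)) in H; [lra|].
    intros k Hk. rewrite Rabs_mult, (Rabs_pos_eq (weight k j)); auto using weight_nonneg. }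
  exists (fun i => Rabs (u i)).
  assert (Hst' : forall j, (j < m)%nat -> sumR m (fun i => Rabs (u i) * weight i j) = Rabs (u j)).
  { intros j Hj.
    pose proof (sumR_nonneg_zero m _ Hle) as H. simpl in H.
    rewrite sumR_minus, sumR_swap in H.
    rewrite (sumR_ext m (fun j => sumR m (fun i => Rabs (u j) * weight j i)) (fun i => Rabs (u i))) in H
      by (intros; rewrite sumR_scal, weight_sum by auto; ring).
    specialize (H ltac:(ring) j Hj). lra. }
  split; auto.
  (* Positivity travels backwards along a path from i to the index i0 with u i0 nonzero: for an arc
     from j to k, stationarity gives |u j| >= |u k| weight k j. *)
  intros i Hi. pose proof (Hsc i i0 Hi Hi0) as Hr.
  assert (H0 : 0 < Rabs (u i0)) by now apply Rabs_pos_lt.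
  clear Hi0 Hu0. induction Hr as [|j k Hr IH Hk Hjk]; auto.
  apply IH. rewrite <- Hst' by now apply (reach_lt i j).
  apply Rlt_le_trans with (Rabs (u k) * weight k j).
  - apply Rmult_lt_0_compat; auto using weight_pos.
  - apply (sumR_term_le m (fun i => Rabs (u i) * weight i j)); auto.
    intros l Hl. apply Rmult_le_pos; [apply Rabs_pos|auto using weight_nonneg].
Qed.

Variable pi : nat -> R.
Hypothesis Hpi : forall i, (i < m)%nat -> 0 < pi i.

Definition dirichlet (n : nat) (w : nat -> vec) : R :=
  sumR m (fun i => sumR m (fun j => pi i * weight i j * nsq n (vsub (w i) (w j)))).

(** Polarise: <w_i, w_i - w_j> is half of |w_i - w_j|^2 + |w_i|^2 - |w_j|^2. In the weighted sum the
    last two terms cancel, one by the row sums, the other by stationarity. *)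
Lemma dirichlet_laplacian n w :
  (forall j, (j < m)%nat -> sumR m (fun i => pi i * weight i j) = pi j) ->
  dirichlet n w = 2 * sumR m (fun i => pi i * dot n (w i) (vsub (w i) (avg i w))).
Proof.
  intros Hst.
  assert (E : forall i, (i < m)%nat -> pi i * dot n (w i) (vsub (w i) (avg i w)) =
    sumR m (fun j => /2 * (pi i * weight i j * nsq n (vsub (w i) (w j)))) +
    sumR m (fun j => /2 * (pi i * nsq n (w i) * weight i j)) -
    sumR m (fun j => /2 * (pi i * weight i j * nsq n (w j)))).
  { intros i Hi. rewrite <- sumR_plus, <- sumR_minus, dot_vsub_r, avg_weight.
    rewrite (dot_comm n (w i) (vsum _ _)), dot_vsum_l.
    replace (nsq n (w i)) with (nsq n (w i) * sumR m (weight i)) at 1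
      by (rewrite weight_sum; auto; ring).
    rewrite <- sumR_scal, <- sumR_minus, <- sumR_scal. apply sumR_ext; intros j Hj.
    vlin. rewrite (dot_comm n (w j) (w i)). field. }
  rewrite (sumR_ext m _ _ E), sumR_minus, sumR_plus.
  assert (E1 : sumR m (fun i => sumR m (fun j => /2 * (pi i * nsq n (w i) * weight i j)))
    = /2 * sumR m (fun i => pi i * nsq n (w i))).
  { rewrite <- sumR_scal. apply sumR_ext; intros i Hi.
    rewrite !sumR_scal, weight_sum; auto. ring. }
  assert (E2 : sumR m (fun i => sumR m (fun j => /2 * (pi i * weight i j * nsq n (w j))))
    = /2 * sumR m (fun i => pi i * nsq n (w i))).
  { rewrite sumR_swap, <- sumR_scal. apply sumR_ext; intros j Hj.
    rewrite sumR_scal, sumR_scal_r, Hst; auto. }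
  rewrite E1, E2. unfold dirichlet.
  rewrite (sumR_ext m (fun i => sumR m (fun j => /2 * _))
    (fun i => /2 * sumR m (fun j => pi i * weight i j * nsq n (vsub (w i) (w j)))))
    by (intros; now rewrite sumR_scal).
  rewrite sumR_scal. field.
Qed.

Lemma dirichlet_term n w i j : (i < m)%nat -> (j < m)%nat ->
  pi i * weight i j * nsq n (vsub (w i) (w j)) <= dirichlet n w.
Proof.
  intros Hi Hj.
  assert (H : forall i j, (i < m)%nat -> 0 <= pi i * weight i j * nsq n (vsub (w i) (w j))).
  { intros k l Hk. pose proof (Hpi k Hk). pose proof (weight_nonneg k l Hk).
    pose proof (nsq_nonneg n (vsub (w k) (w l))).
    apply Rmult_le_pos; [apply Rmult_le_pos|]; lra. }
  apply Rle_trans with (sumR m (fun j => pi i * weight i j * nsq n (vsub (w i) (w j)))).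
  - apply (sumR_term_le m (fun j => pi i * weight i j * nsq n (vsub (w i) (w j)))); auto.
  - apply (sumR_term_le m (fun i => sumR m (fun j => pi i * weight i j * nsq n (vsub (w i) (w j))))); auto.
    intros k Hk. apply sumR_nonneg; auto.
Qed.

Lemma dirichlet_nonneg n w : 0 <= dirichlet n w.
Proof.
  apply sumR_nonneg; intros i Hi. apply sumR_nonneg; intros j Hj.
  pose proof (Hpi i Hi). pose proof (weight_nonneg i j Hi).
  pose proof (nsq_nonneg n (vsub (w i) (w j))). apply Rmult_le_pos; [apply Rmult_le_pos|]; lra.
Qed.

(** Each arc of a path costs a doubling of the constant plus 2 over the weight of that arc in the
    Dirichlet form. *)
Lemma dirichlet_reach n i j : reach adj m i j ->
  exists c, 0 <= c /\ forall w, nsq n (vsub (w i) (w j)) <= c * dirichlet n w.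
Proof.
  induction 1 as [Hi|j k Hr [c [Hc IH]] Hk Hjk].
  - exists 0. split; [lra|]. intros w. vlin. lra.
  - pose proof (reach_lt i j Hr) as [_ Hj].
    set (d := pi k * weight k j).
    assert (Hd : 0 < d) by (apply Rmult_lt_0_compat; auto using weight_pos).
    exists (2 * c + 2 * / d). pose proof (Rinv_0_lt_compat d Hd). split; [lra|].
    intros w. specialize (IH w). pose proof (dirichlet_term n w k j Hk Hj) as H1.
    fold d in H1. apply Rmult_le_compat_l with (r := / d) in H1; [|lra].
    rewrite <- Rmult_assoc, Rinv_l, Rmult_1_l in H1 by lra.
    pose proof (nsq_vsub_le n (vsub (w i) (w j)) (vsub (w k) (w j))) as H2.
    replace (vsub (vsub (w i) (w j)) (vsub (w k) (w j))) with (vsub (w i) (w k)) in H2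
      by (extensionality l; unfold vsub; ring).
    lra.
Qed.
End Graph.

Lemma finite_bound m (F : nat -> R -> Prop) :
  (forall i c c', c <= c' -> F i c -> F i c') ->
  (forall i, (i < m)%nat -> exists c, F i c) ->
  exists c, 0 < c /\ forall i, (i < m)%nat -> F i c.
Proof.
  intros Hmono. induction m as [|m IH]; intros H.
  - exists 1. split; [lra|]. intros; lia.
  - destruct IH as [c [Hc IH]]; [auto|]. destruct (H m) as [d Hd]; [lia|].
    exists (Rmax c d). pose proof (Rmax_l c d). pose proof (Rmax_r c d).
    split; [lra|]. intros i Hi.
    destruct (Nat.eq_dec i m) as [->|]; [now apply Hmono with d|].
    apply Hmono with c; auto. apply IH; lia.
Qed.

(** * Joint observability makes the consensus form coercive *)

Section Coercivity.
Variables (n m : nat) (s : nat -> nat) (A : mat) (C Pm : nat -> mat).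
Hypothesis Hm : (1 < m)%nat.
Hypothesis Hobs : jointly_observable n m s C A.
Hypothesis HP : forall i, (i < m)%nat -> is_orth_proj n (unobs n (s i) (C i) A) (Pm i).

(** The matrix N = sum_i (I - P_i) satisfies <Nv, v> = sum_i |v - P_i v|^2, so its kernel is the
    intersection of the V_i, which is zero. An injective matrix is bounded below. *)
Lemma joint_observability_coercive :
  exists c, 0 < c /\ forall v, nsq n v <= c * sumR m (fun i => nsq n (vsub v (mv n (Pm i) v))).
Proof.
  set (N := fun r c => sumR m (fun i => idm r c + (-1) * Pm i r c)).
  assert (HN : forall v k, (k < n)%nat ->
    mv n N v k = vsum m (fun i => vsub v (mv n (Pm i) v)) k).
  { intros v k Hk. unfold mv at 1, N, vsum.
    rewrite (sumR_ext n _ (fun c => sumR m (fun i => (idm k c + (-1) * Pm i k c) * v c)))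
      by (intros; now rewrite sumR_scal_r).
    rewrite sumR_swap. apply sumR_ext; intros i Hi.
    change (mv n (fun k c => idm k c + (-1) * Pm i k c) v k = vsub v (mv n (Pm i) v) k).
    rewrite mv_plus_mat, mv_scal_mat. unfold vadd, vscal, vsub. rewrite mv_idm; auto. ring. }
  destruct (injective_bounded_below n N) as [b [Hb0 Hb]].
  { intros v Hv.
    assert (E : dot n (mv n N v) v = 0) by now apply dot_zero_l.
    rewrite (dot_ext n _ _ _ v (HN v)) in E by auto. rewrite dot_vsum_l in E.
    rewrite (sumR_ext m _ (fun i => nsq n (vsub v (mv n (Pm i) v)))) in E.
    - pose proof (sumR_nonneg_zero m _ (fun i _ => nsq_nonneg n _) E) as H. simpl in H.
      (* The intersection of the V_i is an admissible subspace for joint observability, and v lies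
         in it because v = P_i v for each i. *)
      apply (Hobs (fun v => forall i, (i < m)%nat -> unobs n (s i) (C i) A v)).
      + repeat split.
        * intros i Hi. apply (unobs_ext n _ _ _ (vscal 0 v)).
          { intros; unfold vscal; ring. }
          apply unobs_vscal. apply (unobs_ext n _ _ _ (mv n (Pm i) v)); [|now apply HP].
          intros k Hk. pose proof (nsq_zero n _ (H i Hi) k Hk) as E1. unfold vsub in E1. lra.
        * intros u w Hu Hw i Hi. now apply unobs_vadd; [apply Hu|apply Hw].
        * intros a u Hu i Hi. apply unobs_vscal; auto.
        * intros u w Euw Hu i Hi. apply (unobs_ext n _ _ _ u); auto.
      + intros u Hu i Hi. apply unobs_mv; auto.
      + intros i Hi u Hu. apply (unobs_ker n (s i) (C i) A); auto.
      + intros i Hi. apply (unobs_ext n _ _ _ (mv n (Pm i) v)); [|now apply HP].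
        intros k Hk. pose proof (nsq_zero n _ (H i Hi) k Hk) as E1. unfold vsub in E1. lra.
    - intros i Hi. destruct (HP i Hi v) as [Vv Ov]. specialize (Ov _ Vv).
      rewrite (dot_vsub_r n v). lra. }
  assert (0 < INR m) by (apply lt_0_INR; lia).
  exists (b * INR m). split; [now apply Rmult_lt_0_compat|]. intros v.
  specialize (Hb v). rewrite (dot_ext n _ _ _ _ (HN v) (HN v)) in Hb.
  pose proof (nsq_vsum_le n m (fun i => vsub v (mv n (Pm i) v))). nra.
Qed.

(** The two-sided bound on [pi] serves at switches, the coercivity between them. [pi] may change
    with the graph, while [b] is to be uniform. *)
Definition consensus_weights (adj : nat -> nat -> bool) (b : R) (pi : nat -> R) : Prop :=
  (forall i, (i < m)%nat -> / b <= pi i <= b) /\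
  forall w, (forall i, (i < m)%nat -> unobs n (s i) (C i) A (w i)) ->
    sumR m (fun i => nsq n (w i)) <=
    b * sumR m (fun i => pi i * dot n (w i) (vsub (w i) (avg m adj i w))).

Lemma consensus_weights_mono adj b b' pi : 0 < b -> b <= b' ->
  consensus_weights adj b pi -> consensus_weights adj b' pi.
Proof.
  intros Hb Hbb [H1 H2]. split.
  - intros i Hi. specialize (H1 i Hi). pose proof (Rinv_le_contravar b b' Hb Hbb). lra.
  - intros w Hw. specialize (H2 w Hw).
    assert (0 <= sumR m (fun i => nsq n (w i))) by (apply sumR_nonneg; intros; apply nsq_nonneg).
    nra.
Qed.

(** A small Dirichlet form keeps every w_i close to w_0. Since w_i is in V_i, w_0 is close to all
    the V_i at once, hence small by joint observability, and then so is every w_i. *)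
Lemma consensus_weights_exist adj : strongly_connected adj m -> self_loops adj m ->
  exists b, 0 < b /\ exists pi, consensus_weights adj b pi.
Proof.
  intros Hsc Hloop.
  destruct (stationary_weights m adj Hloop ltac:(lia) Hsc) as [pi [Hpi Hst]].
  destruct joint_observability_coercive as [c [Hc0 Hc]].
  (* The clause [0 < d] makes the property stable under enlarging [d]. *)
  destruct (finite_bound m (fun i d => / d <= pi i /\ pi i <= d /\ 0 < d)) as [b1 [Hb10 Hb1]].
  { intros i d d' Hd [H1 [H2 H3]]. pose proof (Rinv_le_contravar d d' H3 Hd). lra. }
  { intros i Hi. specialize (Hpi i Hi). exists (Rmax (pi i) (/ pi i)).
    pose proof (Rmax_l (pi i) (/ pi i)). pose proof (Rmax_r (pi i) (/ pi i)).
    pose proof (Rinv_0_lt_compat _ Hpi).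
    pose proof (Rinv_le_contravar _ _ H1 H0) as H2. rewrite Rinv_inv in H2. lra. }
  destruct (finite_bound m (fun i d => forall w, nsq n (vsub (w 0%nat) (w i)) <=
     d * dirichlet m adj pi n w)) as [d [Hd0 Hd]].
  { intros i d d' Hdd H w. specialize (H w).
    pose proof (dirichlet_nonneg m adj Hloop pi Hpi n w). nra. }
  { intros i Hi. destruct (dirichlet_reach m adj Hloop pi Hpi n 0%nat i) as [d [_ Hd]];
      [apply Hsc; lia|]. now exists d. }
  assert (HINR : 0 < INR m) by (apply lt_0_INR; lia).
  (* From |w_i|^2 <= 2 |w_0|^2 + 2 |w_0 - w_i|^2: the outer m comes from summing over i, the last 2
     from [dirichlet_laplacian]. *)
  set (b2 := INR m * (2 * (c * (INR m * d)) + 2 * d) * 2).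
  exists (Rmax b1 b2). pose proof (Rmax_l b1 b2). pose proof (Rmax_r b1 b2).
  split; [lra|]. exists pi. split.
  - intros i Hi. destruct (Hb1 i Hi) as [H1 [H2 H3]].
    pose proof (Rinv_le_contravar b1 (Rmax b1 b2) Hb10 ltac:(lra)). lra.
  - intros w Hw. pose proof (dirichlet_laplacian m adj Hloop pi n w Hst) as HD.
    pose proof (dirichlet_nonneg m adj Hloop pi Hpi n w) as HD0.
    set (D := dirichlet m adj pi n w) in *.
    (* P_i w_0 is the point of V_i nearest to w_0, so it is no farther away than w_i. *)
    assert (Hw0 : nsq n (w 0%nat) <= c * (INR m * d) * D).
    { eapply Rle_trans; [apply Hc|]. rewrite !Rmult_assoc. apply Rmult_le_compat_l; [lra|].
      rewrite <- sumR_const. apply sumR_le; intros i Hi.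
      eapply Rle_trans; [apply (proj_dist_le n (s i) (C i) A (Pm i) (HP i Hi) _ (w i)); auto|].
      now apply Hd. }
    assert (Hwi : sumR m (fun i => nsq n (w i)) <= INR m * ((2 * (c * (INR m * d)) + 2 * d) * D)).
    { rewrite <- sumR_const. apply sumR_le; intros i Hi.
      pose proof (nsq_vsub_le n (w 0%nat) (vsub (w 0%nat) (w i))) as H1.
      replace (vsub (w 0%nat) (vsub (w 0%nat) (w i))) with (w i) in H1
        by (extensionality l; unfold vsub; ring).
      specialize (Hd i Hi w). fold D in Hd. lra. }
    set (S := sumR m (fun i => pi i * _)) in *.
    assert (sumR m (fun i => nsq n (w i)) <= b2 * S) by (unfold b2; rewrite HD in Hwi; lra).
    assert (0 <= S) by lra. nra.
Qed.

Lemma consensus_weights_uniform (T : Type) (l : list T) (arc : T -> nat -> nat -> bool) :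
  (forall p, strongly_connected (arc p) m) -> (forall p, self_loops (arc p) m) ->
  exists b, 1 <= b /\ forall p, In p l -> exists pi, consensus_weights (arc p) b pi.
Proof.
  intros Hsc Hloop. induction l as [|p l [b [Hb IH]]].
  - exists 1. split; [lra|]. intros p [].
  - destruct (consensus_weights_exist (arc p)) as [b' [Hb' [pi Hpi]]]; auto.
    exists (Rmax b b'). pose proof (Rmax_l b b'). pose proof (Rmax_r b b').
    split; [lra|]. intros q [<-|Hq].
    + exists pi. apply consensus_weights_mono with b'; auto.
    + destruct (IH q Hq) as [pi' Hpi']. exists pi'.
      apply consensus_weights_mono with b; auto. lra.
Qed.
End Coercivity.

(** * Right derivatives *)

Lemma rderiv_limit f t l :
  rderiv f t l <-> limit1_in (fun h => (f (t + h) - f t) / h) (fun h => 0 < h) l 0.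
Proof.
  split.
  - intros H eps Heps. destruct (H eps Heps) as [d [Hd Hl]]. exists d. split; auto.
    simpl. unfold Rdist. intros h [Hh Hhd]. apply Hl. split; auto.
    rewrite Rminus_0_r, Rabs_pos_eq in Hhd; lra.
  - intros H eps Heps. destruct (H eps Heps) as [d [Hd Hl]]. exists d. split; auto.
    intros h [Hh Hhd]. apply (Hl h). simpl. unfold Rdist. split; auto.
    rewrite Rminus_0_r, Rabs_pos_eq; lra.
Qed.

Lemma cont_limit f :
  cont_nonneg f <-> forall t, 0 <= t -> limit1_in f (fun u => 0 <= u) (f t) t.
Proof.
  split.
  - intros H t Ht eps Heps. destruct (H t Ht eps Heps) as [d [Hd Hl]]. exists d.
    split; auto. intros u [Hu Hud]. now apply Hl.
  - intros H t Ht eps Heps. destruct (H t Ht eps Heps) as [d [Hd Hl]]. exists d.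
    split; auto. intros u Hu Hud. apply (Hl u). now split.
Qed.

(** The scalar counterpart of [solves]: continuity on the half-line together with a right derivative
    at each of its points. *)
Definition deriv_on (f f' : R -> R) : Prop :=
  cont_nonneg f /\ forall t, 0 <= t -> rderiv f t (f' t).

Lemma limit1_ext (f g : R -> R) D l x :
  (forall y, D y -> f y = g y) -> limit1_in f D l x -> limit1_in g D l x.
Proof.
  intros E H eps Heps. destruct (H eps Heps) as [d [Hd Hl]]. exists d. split; auto.
  intros y [Hy Hyd]. rewrite <- E; auto.
Qed.

Lemma limit1_const c D x : limit1_in (fun _ => c) D c x.
Proof.
  intros eps Heps. exists 1. split; [lra|]. intros y _. simpl. rewrite Rdist_eq. lra.
Qed.

Lemma deriv_on_const c : deriv_on (fun _ => c) (fun _ => 0).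
Proof.
  split.
  - apply cont_limit. intros; apply limit1_const.
  - intros t _. apply rderiv_limit. apply limit1_ext with (fun _ => 0).
    + intros; field; lra.
    + apply limit1_const.
Qed.

Lemma deriv_on_ext f g f' g' :
  (forall t, f t = g t) -> (forall t, 0 <= t -> f' t = g' t) ->
  deriv_on f f' -> deriv_on g g'.
Proof.
  intros E E' [H H']. replace g with f by now extensionality t.
  split; auto. intros t Ht. rewrite <- E'; auto.
Qed.

Lemma deriv_on_plus f g f' g' : deriv_on f f' -> deriv_on g g' ->
  deriv_on (fun t => f t + g t) (fun t => f' t + g' t).
Proof.
  intros [Hf Hf'] [Hg Hg']. split.
  - rewrite cont_limit in *. intros t Ht. apply limit_plus; auto.
  - intros t Ht. specialize (Hf' t Ht). specialize (Hg' t Ht).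
    rewrite rderiv_limit in *.
    eapply limit1_ext; [|apply (limit_plus _ _ _ _ _ _ Hf' Hg')].
    intros h Hh. simpl. field. lra.
Qed.

Lemma deriv_on_mult f g f' g' : deriv_on f f' -> deriv_on g g' ->
  deriv_on (fun t => f t * g t) (fun t => f' t * g t + f t * g' t).
Proof.
  intros [Hf Hf'] [Hg Hg']. split.
  - rewrite cont_limit in *. intros t Ht. apply limit_mul; auto.
  - intros t Ht. specialize (Hf' t Ht). specialize (Hg' t Ht).
    rewrite rderiv_limit in *. set (D := fun h => 0 < h) in *.
    (* The product rule needs g (t + h) to tend to g t; written through the difference quotient of
       g, this follows from its right derivative. *)
    assert (Hgt : limit1_in (fun h => g t + h * ((g (t + h) - g t) / h)) D (g t + 0 * g' t) 0).
    { apply limit_plus; [apply limit1_const|].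
      apply limit_mul; auto. apply (lim_x D). }
    rewrite Rmult_0_l, Rplus_0_r in Hgt.
    eapply limit1_ext; [|apply (limit_plus _ _ _ _ _ _ (limit_mul _ _ _ _ _ _ Hf' Hgt)
      (limit_mul _ _ _ _ _ _ (limit1_const (f t) D 0) Hg'))].
    intros h Hh. simpl. unfold D in Hh. field. lra.
Qed.

Lemma deriv_on_scal a f f' : deriv_on f f' ->
  deriv_on (fun t => a * f t) (fun t => a * f' t).
Proof.
  intros H. eapply deriv_on_ext; [| |apply (deriv_on_mult _ _ _ _ (deriv_on_const a) H)].
  - reflexivity.
  - intros; simpl; ring.
Qed.

Lemma deriv_on_sum m (f f' : nat -> R -> R) :
  (forall i, (i < m)%nat -> deriv_on (f i) (f' i)) ->
  deriv_on (fun t => sumR m (fun i => f i t)) (fun t => sumR m (fun i => f' i t)).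
Proof.
  induction m as [|m IH]; intros H; simpl; [apply deriv_on_const|].
  apply deriv_on_plus; auto.
Qed.

Lemma deriv_on_exp c : deriv_on (fun t => exp (c * t)) (fun t => c * exp (c * t)).
Proof.
  assert (Hd : forall t, derivable_pt_lim (fun t => exp (c * t)) t (c * exp (c * t))).
  { intros t. rewrite (Rmult_comm c (exp _)).
    apply (derivable_pt_lim_comp (fun t => c * t) exp t c (exp (c * t))).
    - pose proof (derivable_pt_lim_scal id c t 1 (derivable_pt_lim_id t)) as Hs.
      now rewrite Rmult_1_r in Hs.
    - apply derivable_pt_lim_exp. }
  split.
  - intros t _ eps Heps.
    assert (Hc : continuity_pt (fun t => exp (c * t)) t).
    { apply derivable_continuous_pt. exists (c * exp (c * t)). apply Hd. }
    destruct (Hc eps Heps) as [d [Hd0 Hl]]. exists d. split; auto.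
    intros u _ Hu. destruct (Req_dec u t) as [->|Hne].
    + rewrite Rminus_diag, Rabs_R0. lra.
    + apply (Hl u). split; auto. split; [exact I|auto].
  - intros t _ eps Heps. destruct (Hd t eps Heps) as [d Hl].
    exists d. split; [apply cond_pos|]. intros h Hh. apply Hl; [lra|].
    rewrite Rabs_pos_eq; lra.
Qed.

Lemma deriv_on_mv n M (u u' : R -> vec) r :
  (forall k, (k < n)%nat -> deriv_on (fun t => u t k) (fun t => u' t k)) ->
  deriv_on (fun t => mv n M (u t) r) (fun t => mv n M (u' t) r).
Proof.
  intros H. apply (deriv_on_sum n (fun k t => M r k * u t k) (fun k t => M r k * u' t k)).
  intros k Hk. apply deriv_on_scal. auto.
Qed.

Lemma deriv_on_dot n (u u' v v' : R -> vec) :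
  (forall k, (k < n)%nat -> deriv_on (fun t => u t k) (fun t => u' t k)) ->
  (forall k, (k < n)%nat -> deriv_on (fun t => v t k) (fun t => v' t k)) ->
  deriv_on (fun t => dot n (u t) (v t)) (fun t => dot n (u' t) (v t) + dot n (u t) (v' t)).
Proof.
  intros Hu Hv.
  eapply deriv_on_ext; [| |apply (deriv_on_sum n (fun k t => u t k * v t k)
    (fun k t => u' t k * v t k + u t k * v' t k))].
  - reflexivity.
  - intros t _. apply sumR_plus.
  - intros k Hk. apply deriv_on_mult; auto.
Qed.

Lemma deriv_on_nonincreasing f f' a b :
  deriv_on f f' -> 0 <= a <= b -> (forall t, a <= t < b -> f' t <= 0) -> f b <= f a.
Proof.
  intros [Hc Hd] Hab Hneg. apply Rnot_lt_le; intros Hlt.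
  assert (Hab' : a < b) by (destruct (Req_dec a b) as [->|]; lra).
  (* Half the slope of the chord, so that f b lies strictly above the line and T < b. *)
  set (eps := (f b - f a) / (2 * (b - a))).
  assert (Heps : 0 < eps) by (apply Rdiv_lt_0_compat; lra).
  assert (Hb : f a + eps * (b - a) < f b).
  { replace (eps * (b - a)) with ((f b - f a) / 2) by (unfold eps; field; lra). lra. }
  set (E := fun t => a <= t <= b /\ f t <= f a + eps * (t - a)).
  destruct (completeness E) as [T [HT1 HT2]].
  - exists b. intros t [Ht _]. lra.
  - exists a. split; lra.
  - assert (HaT : a <= T) by (apply HT1; split; lra).
    assert (HTb : T <= b) by (apply HT2; intros t [Ht _]; lra).
    assert (HET : f T <= f a + eps * (T - a)).
    (* If f T were above the line, f would be above it just before T as well, and T - delta would be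
       a smaller upper bound. *)
    { apply Rnot_lt_le; intros HT.
      set (d := (f T - (f a + eps * (T - a)))).
      destruct (Hc T ltac:(lra) d ltac:(unfold d; lra)) as [delta [Hdelta Hcl]].
      assert (HTd : T <= T - delta); [|lra].
      apply HT2. intros t [Ht Hft]. apply Rnot_lt_le; intros Htd.
      assert (t <= T) by (apply HT1; split; auto).
      specialize (Hcl t ltac:(lra)). rewrite Rabs_left1 in Hcl by lra.
      specialize (Hcl ltac:(lra)). apply Rabs_def2 in Hcl. unfold d in Hcl.
      assert (eps * (t - a) <= eps * (T - a)) by (apply Rmult_le_compat_l; lra). lra. }
    assert (HTlt : T < b) by (destruct (Req_dec T b) as [->|]; lra).
    destruct (Hd T ltac:(lra) eps Heps) as [delta [Hdelta Hdl]].
    set (h := Rmin (delta / 2) (b - T)).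
    assert (Hh : 0 < h <= b - T /\ h < delta).
    { unfold h. pose proof (Rmin_l (delta/2) (b-T)). pose proof (Rmin_r (delta/2) (b-T)).
      split; [split; auto|lra]. apply Rmin_glb_lt; lra. }
    specialize (Hdl h ltac:(lra)). apply Rabs_def2 in Hdl. specialize (Hneg T ltac:(lra)).
    assert (Hq : (f (T + h) - f T) / h < eps) by lra.
    apply Rmult_lt_compat_r with (r := h) in Hq; [|lra].
    unfold Rdiv in Hq. rewrite Rmult_assoc, Rinv_l, Rmult_1_r in Hq by lra.
    assert (T + h <= T); [|lra].
    apply HT1. split; lra.
Qed.

Lemma deriv_on_decay f f' c a b :
  deriv_on f f' -> 0 <= a <= b -> (forall t, a <= t < b -> f' t <= - c * f t) ->
  f b <= exp (- c * (b - a)) * f a.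
Proof.
  intros Hf Hab Hle.
  pose proof (deriv_on_mult _ _ _ _ Hf (deriv_on_exp c)) as H.
  apply (deriv_on_nonincreasing _ _ a b) in H; auto.
  - replace (- c * (b - a)) with (- (c * b) + c * a) by ring.
    rewrite exp_plus, exp_Ropp. pose proof (exp_pos (c * b)).
    apply Rmult_le_reg_r with (exp (c * b)); auto.
    replace (/ exp (c * b) * exp (c * a) * f a * exp (c * b)) with (f a * exp (c * a))
      by (field; lra). lra.
  - intros t Ht. specialize (Hle t Ht). pose proof (exp_pos (c * t)).
    apply Rmult_le_compat_r with (r := exp (c * t)) in Hle; lra.
Qed.

(** * The Lyapunov function of the error *)

(** Picks the gain matrices vertex by vertex, by induction instead of choice; [t0] fills the indices
    from m on. *)
Lemma finite_choice (T : Type) (t0 : T) m (F : nat -> T -> Prop) :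
  (forall i, (i < m)%nat -> exists y, F i y) ->
  exists f, forall i, (i < m)%nat -> F i (f i).
Proof.
  induction m as [|m IH]; intros H.
  - exists (fun _ => t0). intros; lia.
  - destruct IH as [f Hf]; [auto|]. destruct (H m) as [y Hy]; [lia|].
    exists (fun i => if Nat.eqb i m then y else f i). intros i Hi.
    destruct (Nat.eqb_spec i m) as [->|]; auto. apply Hf; lia.
Qed.

(** exp x >= 1 + x at x >= b^2 already exceeds b, which avoids logarithms. It is applied to the
    switching factor b^2, whence the rate (b^2)^2 / tau. *)
Lemma exp_ge_of_dwell b tau d : 0 < tau -> tau <= d -> b <= exp (b ^ 2 / tau * d).
Proof.
  intros Ht Hd.
  assert (b ^ 2 <= b ^ 2 / tau * d).
  { apply Rmult_le_reg_r with tau; auto.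
    replace (b ^ 2 / tau * d * tau) with (b ^ 2 * d) by (field; lra).
    pose proof (pow2_ge_0 b). nra. }
  pose proof (exp_ineq1_le (b ^ 2 / tau * d)).
  pose proof (pow2_ge_0 (b - 1/2)). nra.
Qed.

Section Observer.
Variables (n m : nat) (s : nat -> nat) (A : mat) (C Pm : nat -> mat).
Hypothesis HP : forall i, (i < m)%nat -> is_orth_proj n (unobs n (s i) (C i) A) (Pm i).

Definition closed_loop (K : nat -> mat) (i : nat) (v : vec) : vec :=
  vadd (mv n A v) (mv (s i) (K i) (mv n (C i) v)).

Definition observer_gains (mu : R) (K Q : nat -> mat) (d : R) (i : nat) : Prop :=
  (forall u v, dot n (mv n (Q i) u) v = dot n u (mv n (Q i) v)) /\
  (forall v, 0 <= dot n v (mv n (Q i) v)) /\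
  (forall v, nsq n (vsub v (mv n (Pm i) v)) <= d * dot n v (mv n (Q i) v)) /\
  (forall v, dot n v (mv n (Q i) v) <= d * nsq n v) /\
  (forall v w, dot n (mv n (Q i) v) (mv n (Pm i) w) = 0) /\
  (forall v, dot n (mv n (Q i) v) (closed_loop K i v) <= - mu * dot n v (mv n (Q i) v)) /\
  (forall v, nsq n (closed_loop K i v) <= d * nsq n v).

Lemma observer_gains_exist mu : exists K Q d, 1 <= d /\
  forall i, (i < m)%nat -> observer_gains mu K Q d i.
Proof.
  destruct (finite_choice (mat * mat) (idm, idm) m
    (fun i KQ => exists d, 1 <= d /\ observer_gains mu (fun _ => fst KQ) (fun _ => snd KQ) d i))
    as [f Hf].
  { intros i Hi.
    destruct (observer_gain n (s i) A (C i) (Pm i) mu (HP i Hi))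
      as [K [Q [alpha [beta [Ha [Hb [Hs [Hl [Hu [HQP Hd]]]]]]]]]].
    exists (K, Q). simpl.
    destruct (mv_bounded n n (fun r c => A r c + sumR (s i) (fun k => K r k * C i k c)))
      as [a [Ha0 HA]].
    pose proof (Rinv_0_lt_compat _ Ha) as Hia.
    exists (/ alpha + beta + a + 1). split; [lra|].
    assert (Hp : forall v, 0 <= dot n v (mv n Q v)).
    { intros v. eapply Rle_trans; [|apply Hl]. apply Rmult_le_pos; [lra|apply nsq_nonneg]. }
    repeat split; auto; intros v; pose proof (nsq_nonneg n v).
    - specialize (Hl v). apply Rmult_le_compat_l with (r := / alpha) in Hl; [|lra].
      rewrite <- Rmult_assoc, Rinv_l, Rmult_1_l in Hl by lra. specialize (Hp v). nra.
    - specialize (Hu v). nra.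
    - specialize (HA v). rewrite mv_plus_mat, mv_mul_mat in HA.
      unfold closed_loop. nra. }
  destruct (finite_bound m (fun i d => 1 <= d /\
     observer_gains mu (fun i => fst (f i)) (fun i => snd (f i)) d i)) as [d [_ Hd]].
  { intros i d d' Hdd [H1 [Hs [Hp [Hz [Hu [HQP [Hd Hc]]]]]]]. split; [lra|].
    repeat split; auto; intros v; pose proof (nsq_nonneg n v).
    - specialize (Hz v). specialize (Hp v). nra.
    - specialize (Hu v). nra.
    - specialize (Hc v). nra. }
  { intros i Hi. destruct (Hf i Hi) as [d Hd]. exists d. exact Hd. }
  exists (fun i => fst (f i)), (fun i => snd (f i)), (Rmax d 1).
  split; [apply Rmax_r|]. intros i Hi. destruct (Hd i Hi) as [H1 H2].
  rewrite Rmax_left; auto.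
Qed.

Variables (mu : R) (K Q : nat -> mat) (d : R).
Hypothesis Hmu : 0 < mu.
Hypothesis Hd : 1 <= d.
Hypothesis HK : forall i, (i < m)%nat -> observer_gains (mu + 1) K Q d i.

Definition error_field (g : R) (adj : nat -> nat -> bool) (i : nat) (e : nat -> vec) : vec :=
  vsub (closed_loop K i (e i)) (vscal g (mv n (Pm i) (vsub (e i) (avg m adj i e)))).

Definition lyap (kappa : R) (pi : nat -> R) (e : nat -> vec) : R :=
  sumR m (fun i => pi i * nsq n (mv n (Pm i) (e i)) + kappa * dot n (e i) (mv n (Q i) (e i))).

Definition lyap_dot (kappa : R) (pi : nat -> R) (e f : nat -> vec) : R :=
  sumR m (fun i => pi i * (2 * dot n (mv n (Pm i) (e i)) (mv n (Pm i) (f i)))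
    + kappa * (2 * dot n (mv n (Q i) (e i)) (f i))).

Variable b : R.
Hypothesis Hb : 1 <= b.

(** kappa / d is the total coefficient of sum_i |z_i|^2 produced by [error_field_estimate]; the
    second factor m comes from summing the coupling term over i. *)
Definition kappa_of (g : R) : R := d * (b * d + g * b ^ 3 * INR m ^ 2).

Lemma kappa_pos g : 0 <= g -> 0 < kappa_of g.
Proof.
  intros Hg. unfold kappa_of. apply Rmult_lt_0_compat; [lra|].
  assert (0 <= g * b ^ 3 * INR m ^ 2).
  { apply Rmult_le_pos; [apply Rmult_le_pos; auto; apply pow_le; lra|apply pow2_ge_0]. }
  assert (0 < b * d) by (apply Rmult_lt_0_compat; lra). lra.
Qed.

(* Splitting [e i] into [w = P e] and [z = e - w], the cross terms [<w, z>] vanish and the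
   coupling through [avg z] is absorbed by AM-GM with parameter [1 / b^2]. *)
Lemma error_field_estimate g adj pi e i :
  0 <= g -> self_loops adj m -> (forall i, (i < m)%nat -> / b <= pi i <= b) ->
  (i < m)%nat ->
  let w i := mv n (Pm i) (e i) in
  let z i := vsub (e i) (w i) in
  pi i * (2 * dot n (w i) (mv n (Pm i) (error_field g adj i e))) <=
    (b * (1 + d) + g / b) * nsq n (w i) + b * d * nsq n (z i)
    + g * b ^ 3 * INR m * sumR m (fun j => nsq n (z j))
    - 2 * g * (pi i * dot n (w i) (vsub (w i) (avg m adj i w))).
Proof.
  intros Hg Hloop Hpi Hi w z.
  specialize (Hpi i Hi). pose proof (HP i Hi) as HPi.
  assert (Hib : 0 < / b) by (apply Rinv_0_lt_compat; lra).
  destruct (HK i Hi) as [_ [_ [_ [_ [_ [_ Hc]]]]]]. specialize (Hc (e i)).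
  set (F := closed_loop K i (e i)) in *.
  assert (Hww : forall k, (k < n)%nat -> mv n (Pm i) (w i) k = w i k).
  { apply (proj_fix n (s i) (C i) A (Pm i) HPi). apply HPi. }
  assert (HPw : forall v, dot n (w i) (mv n (Pm i) v) = dot n (w i) v).
  { intros v. rewrite <- (proj_sym n (s i) (C i) A (Pm i) HPi).
    now apply dot_ext. }
  assert (Hwz : dot n (w i) (z i) = 0).
  { rewrite dot_comm. apply HPi. apply HPi. }
  assert (Ee : nsq n (e i) = nsq n (w i) + nsq n (z i))
    by apply (proj_pythagoras n (s i) (C i) A (Pm i) HPi).
  rewrite Ee in Hc.
  assert (Ey : vsub (e i) (avg m adj i e) =
    vadd (vsub (w i) (avg m adj i w)) (vsub (z i) (avg m adj i z))).
  { replace e with (fun j => vadd (w j) (z j)) at 2.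
    - rewrite avg_vadd. extensionality k. unfold z, vsub, vadd. ring.
    - extensionality j. extensionality k. unfold z, vsub, vadd. ring. }
  rewrite HPw. unfold error_field. fold F.
  rewrite dot_vsub_r, dot_vscal_r, HPw, Ey, dot_vadd_r, (dot_vsub_r n (z i)), Hwz.
  set (T := dot n (w i) (vsub (w i) (avg m adj i w))).
  pose proof (nsq_avg_le m adj Hloop n i z Hi) as Hz.
  set (Z := sumR m (fun j => nsq n (z j))) in *.
  pose proof (dot_le n 1 (w i) F ltac:(lra)) as H1.
  pose proof (dot_le n (/ b ^ 2) (w i) (avg m adj i z)) as H2.
  assert (Hb2 : 0 < b ^ 2) by (apply pow_lt; lra).
  specialize (H2 (Rinv_0_lt_compat _ Hb2)).
  unfold Rdiv in H2. rewrite Rinv_inv in H2.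
  pose proof (nsq_nonneg n (w i)) as HX. pose proof (nsq_nonneg n (z i)) as HZi.
  pose proof (nsq_nonneg n (avg m adj i z)) as Hza.
  set (X := nsq n (w i)) in *. set (Zi := nsq n (z i)) in *.
  assert (G1 : pi i * (2 * dot n (w i) F) <= b * ((1 + d) * X + d * Zi)).
  { apply Rle_trans with (pi i * ((1 + d) * X + d * Zi)).
    - apply Rmult_le_compat_l; lra.
    - apply Rmult_le_compat_r; [|lra].
      apply Rplus_le_le_0_compat; apply Rmult_le_pos; lra. }
  assert (G2 : pi i * (2 * dot n (w i) (avg m adj i z)) <= X / b + b ^ 3 * INR m * Z).
  { apply Rle_trans with (pi i * (/ b ^ 2 * X + INR m * Z * b ^ 2)).
    - apply Rmult_le_compat_l; [lra|]. eapply Rle_trans; [exact H2|].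
      apply Rplus_le_compat_l, Rmult_le_compat_r; lra.
    - apply Rle_trans with (b * (/ b ^ 2 * X + INR m * Z * b ^ 2)).
      + apply Rmult_le_compat_r; [|lra]. apply Rplus_le_le_0_compat.
        * apply Rmult_le_pos; auto. left. now apply Rinv_0_lt_compat.
        * apply Rmult_le_pos; lra.
      + right. field. lra. }
  apply Rmult_le_compat_l with (r := g) in G2; auto.
  unfold Rdiv in *. lra.
Qed.

(** Consensus supplies 2g/b on sum_i |w_i|^2. Half of it absorbs the g/b left by AM-GM, the other
    half covers b(1 + d + 2 mu), which is the threshold on g. The gains decay at rate mu + 1 instead
    of mu; the surplus -2 kappa q_i is at most -2 (kappa/d) |z_i|^2 and absorbs the z terms. *)
Lemma lyap_decrease g adj pi e :
  b ^ 2 * (1 + d + 2 * mu) <= g -> self_loops adj m ->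
  consensus_weights n m s A C adj b pi ->
  lyap_dot (kappa_of g) pi e (fun i => error_field g adj i e) <=
    - (2 * mu) * lyap (kappa_of g) pi e.
Proof.
  intros Hg Hloop [Hpi Hw].
  assert (Hb2 : 0 < b ^ 2) by (apply pow_lt; lra).
  assert (Hg0 : 0 <= g).
  { eapply Rle_trans; [|exact Hg]. apply Rmult_le_pos; lra. }
  pose proof (kappa_pos g Hg0) as Hk. set (kappa := kappa_of g) in *.
  set (w := fun i => mv n (Pm i) (e i)). set (z := fun i => vsub (e i) (w i)).
  specialize (Hw w (fun i Hi => proj1 (HP i Hi (e i)))).
  set (X := fun i => nsq n (w i)) in *. set (Z := fun i => nsq n (z i)).
  set (T := fun i => pi i * dot n (w i) (vsub (w i) (avg m adj i w))) in *.
  assert (HX : 0 <= sumR m X) by (apply sumR_nonneg; intros; apply nsq_nonneg).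
  assert (HZ : 0 <= sumR m Z) by (apply sumR_nonneg; intros; apply nsq_nonneg).
  assert (Hi : forall i, (i < m)%nat ->
    pi i * (2 * dot n (mv n (Pm i) (e i)) (mv n (Pm i) (error_field g adj i e)))
    + kappa * (2 * dot n (mv n (Q i) (e i)) (error_field g adj i e))
    + 2 * mu * (pi i * nsq n (mv n (Pm i) (e i)) + kappa * dot n (e i) (mv n (Q i) (e i)))
    <= ((b * (1 + d) + g / b + 2 * mu * b) * X i + (b * d - 2 * kappa / d) * Z i
       + g * b ^ 3 * INR m * sumR m Z) - 2 * g * T i).
  { intros i Hi. pose proof (error_field_estimate g adj pi e i Hg0 Hloop Hpi Hi) as H1.
    cbv zeta in H1. fold (w i) in *. fold w in H1. fold z in H1.
    change (sumR m (fun j => nsq n (z j))) with (sumR m Z) in H1.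
    change (nsq n (z i)) with (Z i) in H1.
    change (nsq n (w i)) with (X i) in *.
    specialize (Hpi i Hi). fold (T i) in H1.
    destruct (HK i Hi) as [_ [Hp [Hz [_ [HQP [Hdec _]]]]]].
    specialize (Hp (e i)). specialize (Hz (e i)). specialize (Hdec (e i)).
    change (nsq n (vsub (e i) (mv n (Pm i) (e i)))) with (Z i) in Hz.
    assert (E : dot n (mv n (Q i) (e i)) (error_field g adj i e) =
      dot n (mv n (Q i) (e i)) (closed_loop K i (e i))).
    { unfold error_field. rewrite dot_vsub_r, dot_vscal_r, HQP. ring. }
    rewrite E. set (q := dot n (e i) (mv n (Q i) (e i))) in *.
    assert (G1 : pi i * X i <= b * X i) by (apply Rmult_le_compat_r; [apply nsq_nonneg|lra]).
    assert (G2 : Z i / d <= q).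
    { apply Rmult_le_reg_r with d; [lra|]. unfold Rdiv.
      rewrite Rmult_assoc, Rinv_l by lra. lra. }
    apply Rmult_le_compat_l with (r := 2 * kappa) in G2; [|lra].
    apply Rmult_le_compat_l with (r := 2 * mu) in G1; [|lra].
    apply Rmult_le_compat_l with (r := 2 * kappa) in Hdec; [|lra].
    unfold Rdiv in *. lra. }
  apply sumR_le in Hi.
  rewrite sumR_minus, !sumR_plus, !sumR_scal, sumR_const, sumR_plus, sumR_scal in Hi.
  unfold lyap_dot, lyap. rewrite !sumR_plus, !sumR_scal.
  assert (G : (b * (1 + d) + g / b + 2 * mu * b) * sumR m X <= 2 * g * sumR m T).
  { apply Rle_trans with (2 * (g / b) * sumR m X).
    - apply Rmult_le_compat_r; auto.
      assert (b * (1 + d + 2 * mu) <= g / b); [|lra].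
      apply Rmult_le_reg_r with b; [lra|]. unfold Rdiv.
      rewrite (Rmult_assoc g), Rinv_l by lra. lra.
    - replace (2 * (g / b) * sumR m X) with (2 * g * (sumR m X / b)) by (field; lra).
      apply Rmult_le_compat_l; [lra|].
      apply Rmult_le_reg_r with b; [lra|]. unfold Rdiv.
      rewrite Rmult_assoc, Rinv_l by lra. lra. }
  assert (G2 : (b * d - 2 * kappa / d) * sumR m Z + INR m * (g * b ^ 3 * INR m * sumR m Z) <= 0).
  { replace (2 * kappa / d) with (2 * (b * d + g * b ^ 3 * INR m ^ 2))
      by (unfold kappa, kappa_of; field; lra).
    assert (0 <= g * b ^ 3 * INR m ^ 2).
    { apply Rmult_le_pos; [apply Rmult_le_pos; auto; apply pow_le; lra|apply pow2_ge_0]. }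
    assert (0 <= b * d) by (apply Rmult_le_pos; lra).
    assert (0 <= (b * d + g * b ^ 3 * INR m ^ 2) * sumR m Z) by (apply Rmult_le_pos; lra).
    lra. }
  lra.
Qed.
(** Only the weights change: pi' <= b and pi >= 1/b account for b^2, and the q_i part is common to
    both sides. *)
Lemma lyap_switch g adj adj' pi pi' e : 0 <= g ->
  consensus_weights n m s A C adj b pi -> consensus_weights n m s A C adj' b pi' ->
  lyap (kappa_of g) pi' e <= b ^ 2 * lyap (kappa_of g) pi e.
Proof.
  intros Hg [Hpi _] [Hpi' _]. unfold lyap. rewrite <- sumR_scal.
  apply sumR_le; intros i Hi. specialize (Hpi i Hi). specialize (Hpi' i Hi).
  pose proof (kappa_pos g Hg) as Hk.
  destruct (HK i Hi) as [_ [Hp _]]. specialize (Hp (e i)).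
  apply Rmult_le_pos with (r1 := kappa_of g) in Hp; [|lra].
  pose proof (nsq_nonneg n (mv n (Pm i) (e i))) as HX.
  rewrite Rmult_plus_distr_l. apply Rplus_le_compat.
  - rewrite <- Rmult_assoc. apply Rmult_le_compat_r; auto.
    apply Rle_trans with (b ^ 2 * / b); [|apply Rmult_le_compat_l; [apply pow2_ge_0|lra]].
    replace (b ^ 2 * / b) with b by (field; lra). lra.
  - rewrite <- (Rmult_1_l (kappa_of g * _)) at 1. apply Rmult_le_compat_r; auto.
    pose proof (pow_R1_Rle b 2 Hb). lra.
Qed.

(** The two parts of U control |P_i e_i|^2 and |e_i - P_i e_i|^2 respectively; Pythagoras combines
    them. The constants do not involve [pi], so they apply at every time. *)
Lemma lyap_bounds g adj pi e : 0 <= g -> consensus_weights n m s A C adj b pi ->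
  Rmin (/ b) (kappa_of g / d) * sumR m (fun i => nsq n (e i)) <= lyap (kappa_of g) pi e /\
  lyap (kappa_of g) pi e <= (b + kappa_of g * d) * sumR m (fun i => nsq n (e i)).
Proof.
  intros Hg [Hpi _]. pose proof (kappa_pos g Hg) as Hk. set (kappa := kappa_of g) in *.
  unfold lyap. rewrite <- !sumR_scal.
  assert (H : forall i, (i < m)%nat ->
    Rmin (/ b) (kappa / d) * nsq n (e i) <=
      pi i * nsq n (mv n (Pm i) (e i)) + kappa * dot n (e i) (mv n (Q i) (e i)) /\
    pi i * nsq n (mv n (Pm i) (e i)) + kappa * dot n (e i) (mv n (Q i) (e i)) <=
      (b + kappa * d) * nsq n (e i)).
  { intros i Hi. specialize (Hpi i Hi).
    destruct (HK i Hi) as [_ [_ [Hz [Hq _]]]]. specialize (Hz (e i)). specialize (Hq (e i)).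
    pose proof (proj_pythagoras n (s i) (C i) A (Pm i) (HP i Hi) (e i)) as E.
    pose proof (nsq_nonneg n (mv n (Pm i) (e i))) as HX.
    pose proof (nsq_nonneg n (vsub (e i) (mv n (Pm i) (e i)))) as HZ.
    apply Rmult_le_compat_l with (r := kappa) in Hq; [|lra].
    assert (Hz' : kappa / d * nsq n (vsub (e i) (mv n (Pm i) (e i)))
      <= kappa * dot n (e i) (mv n (Q i) (e i))).
    { apply Rmult_le_reg_l with d; [lra|].
      replace (d * (kappa / d * nsq n (vsub (e i) (mv n (Pm i) (e i)))))
        with (kappa * nsq n (vsub (e i) (mv n (Pm i) (e i)))) by (field; lra).
      apply Rmult_le_compat_l with (r := kappa) in Hz; lra. }
    pose proof (Rmin_l (/ b) (kappa / d)) as M1. pose proof (Rmin_r (/ b) (kappa / d)) as M2.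
    split.
    - rewrite E, Rmult_plus_distr_l. apply Rplus_le_compat.
      + apply Rmult_le_compat_r; lra.
      + eapply Rle_trans; [|exact Hz']. now apply Rmult_le_compat_r.
    - assert (pi i * nsq n (mv n (Pm i) (e i)) <= b * nsq n (e i)).
      { apply Rmult_le_compat; try lra.
        apply Rle_trans with (/ b); [left; apply Rinv_0_lt_compat; lra|lra]. }
      lra. }
  split; apply sumR_le; intros i Hi; now apply H.
Qed.

(** * Decay along a switched trajectory *)

Section Trajectory.
Variables (T : Type) (arc : T -> nat -> nat -> bool) (sigma : R -> T) (e : nat -> R -> vec).
Variables (g lambda tauD : R).
Hypothesis Hg : b ^ 2 * (1 + d + 2 * mu) <= g.
Hypothesis Hloop : forall p, self_loops (arc p) m.
Hypothesis Hweights : forall p, exists pi, consensus_weights n m s A C (arc p) b pi.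
Hypothesis HtauD : 0 < tauD.
Hypothesis Hmul : 2 * mu = 2 * lambda + (b ^ 2) ^ 2 / tauD.
Hypothesis Hdwell : dwell_signal tauD sigma.
Hypothesis He : forall i k, (i < m)%nat -> (k < n)%nat ->
  deriv_on (fun t => e i t k)
    (fun t => error_field g (arc (sigma t)) i (fun j => e j t) k).

Let state (t : R) : nat -> vec := fun i => e i t.

Lemma gain_nonneg : 0 <= g.
Proof.
  eapply Rle_trans; [|exact Hg]. apply Rmult_le_pos; [apply pow2_ge_0|lra].
Qed.

Lemma lyap_deriv kappa pi :
  deriv_on (fun t => lyap kappa pi (state t))
    (fun t => lyap_dot kappa pi (state t)
       (fun i => error_field g (arc (sigma t)) i (state t))).
Proof.
  apply (deriv_on_sum m
    (fun i t => pi i * nsq n (mv n (Pm i) (e i t)) + kappa * dot n (e i t) (mv n (Q i) (e i t)))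
    (fun i t => let f := error_field g (arc (sigma t)) i (state t) in
       pi i * (2 * dot n (mv n (Pm i) (e i t)) (mv n (Pm i) f))
       + kappa * (2 * dot n (mv n (Q i) (e i t)) f))).
  intros i Hi. set (f := fun t => error_field g (arc (sigma t)) i (state t)).
  assert (Hi' : forall k, (k < n)%nat -> deriv_on (fun t => e i t k) (fun t => f t k))
    by (intros; now apply He).
  apply deriv_on_plus; apply deriv_on_scal.
  - eapply deriv_on_ext; [| |apply (deriv_on_dot n (fun t => mv n (Pm i) (e i t))
      (fun t => mv n (Pm i) (f t)) (fun t => mv n (Pm i) (e i t)) (fun t => mv n (Pm i) (f t)));
      intros; now apply deriv_on_mv].
    + reflexivity.
    + intros t _. cbv beta. rewrite (dot_comm n (mv n (Pm i) (f t))). fold (f t). ring.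
  - eapply deriv_on_ext; [| |apply (deriv_on_dot n (e i) f (fun t => mv n (Q i) (e i t))
      (fun t => mv n (Q i) (f t))); auto; intros; now apply deriv_on_mv].
    + reflexivity.
    + intros t _. cbv beta. destruct (HK i Hi) as [Hs _].
      rewrite <- (Hs (e i t)), (dot_comm n (f t)). fold (f t). ring.
Qed.

Lemma lyap_decay_interval pi a c : 0 <= a <= c ->
  (forall t, a <= t < c -> sigma t = sigma a) ->
  consensus_weights n m s A C (arc (sigma a)) b pi ->
  lyap (kappa_of g) pi (state c) <=
    exp (- (2 * mu) * (c - a)) * lyap (kappa_of g) pi (state a).
Proof.
  intros Hac Hsig Hpi.
  apply (deriv_on_decay _ _ (2 * mu) a c (lyap_deriv (kappa_of g) pi)); auto.
  intros t Ht. apply lyap_decrease; auto. now rewrite (Hsig t Ht).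
Qed.

Lemma lyap_decay t : 0 <= t -> exists p pi, consensus_weights n m s A C (arc p) b pi /\
  lyap (kappa_of g) pi (state t) <= exp (- (2 * lambda) * t) *
    ((b + kappa_of g * d) * sumR m (fun i => nsq n (e i 0))).
Proof.
  intros Ht. destruct Hdwell as [ts [Hts0 [Hts Hsig]]].
  pose proof gain_nonneg as Hg0.
  set (M := (b + kappa_of g * d) * sumR m (fun i => nsq n (e i 0))).
  assert (Hlow : forall k, INR k * tauD <= ts k).
  { induction k as [|k IH]; [rewrite Hts0; simpl; lra|].
    rewrite S_INR. specialize (Hts k). lra. }
  assert (Hpos : forall k, 0 <= ts k).
  { intros k. eapply Rle_trans; [|apply Hlow]. apply Rmult_le_pos; [apply pos_INR|lra]. }
  (* Stated for every admissible [pi] of the graph that becomes active at [ts k]: the preceding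
     interval is run with other weights [pi0], and the bound must hold after the change. *)
  assert (Hk : forall k pi, consensus_weights n m s A C (arc (sigma (ts k))) b pi ->
    lyap (kappa_of g) pi (state (ts k)) <= exp (- (2 * lambda) * ts k) * M).
  { induction k as [|k IH]; intros pi Hpi.
    - rewrite Hts0, Rmult_0_r, exp_0, Rmult_1_l.
      apply (lyap_bounds g _ pi (state 0) Hg0 Hpi).
    - destruct (Hweights (sigma (ts k))) as [pi0 Hpi0]. specialize (IH pi0 Hpi0).
      specialize (Hts k). specialize (Hpos k).
      pose proof (lyap_switch g _ _ pi0 pi (state (ts (S k))) Hg0 Hpi0 Hpi) as H1.
      pose proof (lyap_decay_interval pi0 (ts k) (ts (S k)) ltac:(lra) (Hsig k) Hpi0) as H2.
      set (D := ts (S k) - ts k) in *.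
      pose proof (exp_ge_of_dwell (b ^ 2) tauD D HtauD ltac:(lra)) as H3.
      (* The exponent is split so that its first summand pays the factor b^2 of the switch ending
         the interval. *)
      replace (- (2 * lambda) * ts (S k)) with
        ((b ^ 2) ^ 2 / tauD * D + (- (2 * mu) * D + - (2 * lambda) * ts k))
        by (unfold D; rewrite Hmul; ring).
      rewrite !exp_plus, !Rmult_assoc.
      eapply Rle_trans; [exact H1|].
      assert (H4 : lyap (kappa_of g) pi0 (state (ts (S k))) <=
        exp (- (2 * mu) * D) * (exp (- (2 * lambda) * ts k) * M)).
      { eapply Rle_trans; [exact H2|]. apply Rmult_le_compat_l; auto. left; apply exp_pos. }
      assert (H5 : 0 <= exp (- (2 * mu) * D) * (exp (- (2 * lambda) * ts k) * M)).
      { pose proof (exp_pos (- (2 * mu) * D)). pose proof (exp_pos (- (2 * lambda) * ts k)).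
        apply Rmult_le_pos; [lra|]. apply Rmult_le_pos; [lra|]. apply Rmult_le_pos.
        - pose proof (kappa_pos g Hg0). assert (0 < kappa_of g * d) by (apply Rmult_lt_0_compat; lra). lra.
        - apply sumR_nonneg; intros; apply nsq_nonneg. }
      eapply Rle_trans; [apply Rmult_le_compat_l; [apply pow2_ge_0|exact H4]|].
      now apply Rmult_le_compat_r. }
  assert (Hloc : forall N, t < ts N -> exists k, ts k <= t < ts (S k)).
  { induction N as [|N IH]; intros HN; [rewrite Hts0 in HN; lra|].
    destruct (Rlt_le_dec t (ts N)); [now apply IH|]. now exists N. }
  destruct (INR_unbounded (t / tauD)) as [N HN].
  destruct (Hloc N) as [k Htk].
  { eapply Rlt_le_trans; [|apply Hlow].
    apply Rmult_gt_compat_r with (r := tauD) in HN; auto.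
    unfold Rdiv in HN. rewrite Rmult_assoc, Rinv_l in HN; lra. }
  destruct (Hweights (sigma (ts k))) as [pi Hpi]. exists (sigma (ts k)), pi. split; auto.
  specialize (Hpos k).
  pose proof (lyap_decay_interval pi (ts k) t ltac:(lra)
    (fun u Hu => Hsig k u ltac:(lra)) Hpi) as H1.
  eapply Rle_trans; [exact H1|].
  eapply Rle_trans; [apply Rmult_le_compat_l; [left; apply exp_pos|apply (Hk k pi Hpi)]|].
  rewrite <- Rmult_assoc, <- exp_plus. apply Rmult_le_compat_r.
  - apply Rmult_le_pos; [|apply sumR_nonneg; intros; apply nsq_nonneg].
    pose proof (kappa_pos g Hg0). assert (0 < kappa_of g * d) by (apply Rmult_lt_0_compat; lra). lra.
  (* The last interval may be shorter than the dwell time, but no switch is paid at its end, so the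
     extra rate is simply dropped. *)
  - assert (0 <= (b ^ 2) ^ 2 / tauD * (t - ts k)).
    { apply Rmult_le_pos; [|lra]. apply Rmult_le_pos; [apply pow2_ge_0|].
      left; now apply Rinv_0_lt_compat. }
    assert (Hle : - (2 * mu) * (t - ts k) + - (2 * lambda) * ts k <= - (2 * lambda) * t)
      by (rewrite Hmul; lra).
    destruct Hle as [Hle|Hle]; [left; now apply exp_increasing|right; now rewrite Hle].
Qed.

Lemma error_decay t : 0 <= t ->
  sumR m (fun i => nsq n (e i t)) <=
    (b + kappa_of g * d) / Rmin (/ b) (kappa_of g / d) * exp (- (2 * lambda) * t)
      * sumR m (fun i => nsq n (e i 0)).
Proof.
  intros Ht. destruct (lyap_decay t Ht) as [p [pi [Hpi H]]].
  pose proof gain_nonneg as Hg0. pose proof (kappa_pos g Hg0) as Hk.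
  pose proof (proj1 (lyap_bounds g _ pi (state t) Hg0 Hpi)) as H1.
  set (c := Rmin (/ b) (kappa_of g / d)) in *.
  assert (Hc : 0 < c).
  { apply Rmin_glb_lt; [apply Rinv_0_lt_compat; lra|apply Rdiv_lt_0_compat; lra]. }
  apply Rmult_le_reg_l with c; auto.
  replace (c * ((b + kappa_of g * d) / c * exp (- (2 * lambda) * t)
    * sumR m (fun i => nsq n (e i 0)))) with
    (exp (- (2 * lambda) * t) * ((b + kappa_of g * d) * sumR m (fun i => nsq n (e i 0))))
    by (field; lra).
  eapply Rle_trans; [exact H1|exact H].
Qed.
End Trajectory.
End Observer.

(** * From the observer equations to the error estimate *)

Lemma observer_error_deriv n m s A C Pm K g (T : Type) (arc : T -> nat -> nat -> bool)
  (sigma : R -> T) (x : R -> vec) (xs : nat -> R -> vec) :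
  (forall p, self_loops (arc p) m) ->
  solves n x (fun _ v => mv n A v) ->
  (forall i, (i < m)%nat ->
     solves n (xs i)
       (fun t v => observer_rhs n m s A C K Pm g arc (sigma t) i
                     (fun j => if Nat.eqb j i then v else xs j t)
                     (mv n (C i) (x t)))) ->
  forall i k, (i < m)%nat -> (k < n)%nat ->
  deriv_on (fun t => vsub (xs i t) (x t) k)
    (fun t => error_field n m s A C Pm K g (arc (sigma t)) i
       (fun j => vsub (xs j t) (x t)) k).
Proof.
  intros Hloop Hx Hxs i k Hi Hk.
  pose proof (deriv_on_plus _ _ _ _ (Hxs i Hi k Hk) (deriv_on_scal (-1) _ _ (Hx k Hk))) as H.
  eapply deriv_on_ext; [| |exact H].
  - intros t. unfold vsub. ring.
  - intros t _. cbv beta.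
    (* The right-hand side has its own state variable in slot i; along the solution that slot is xs
       i t again. *)
    replace (fun j => if Nat.eqb j i then xs i t else xs j t) with (fun j => xs j t)
      by (extensionality j; destruct (Nat.eqb_spec j i) as [->|]; reflexivity).
    unfold observer_rhs, error_field, closed_loop. cbv zeta.
    change (fun k0 => / INR (cnt m (fun j => arc (sigma t) j i)) *
      sumR m (fun j => if arc (sigma t) j i then xs j t k0 else 0))
      with (avg m (arc (sigma t)) i (fun j => xs j t)).
    (* The averaging weights sum to 1, so the plant state drops out of the consensus term. *)
    assert (Ea : vsub (vsub (xs i t) (x t)) (avg m (arc (sigma t)) i (fun j => vsub (xs j t) (x t)))
      = vsub (xs i t) (avg m (arc (sigma t)) i (fun j => xs j t))).
    { rewrite !avg_weight. extensionality l. unfold vsub, vsum, vscal.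
      rewrite (sumR_ext m (fun j => _ * (xs j t l - x t l))
        (fun j => weight m (arc (sigma t)) i j * xs j t l
          - x t l * weight m (arc (sigma t)) i j)) by (intros; ring).
      rewrite sumR_minus, sumR_scal, (weight_sum m _ (Hloop (sigma t))); auto. ring. }
    rewrite Ea, !mv_vsub. unfold vsub, vadd, vscal. ring.
Qed.

Theorem theorem1
  (n m : nat) (s : nat -> nat) (A : mat) (C : nat -> mat)
  (Hm : (1 < m)%nat)
  (Hobs : jointly_observable n m s C A)
  (Pm : nat -> mat)
  (HPm : forall i, (i < m)%nat -> is_orth_proj n (unobs n (s i) (C i) A) (Pm i))
  (P : Type) (Plist : list P) (HPfin : forall p : P, In p Plist)
  (arc : P -> nat -> nat -> bool)
  (Hsc : forall p, strongly_connected (arc p) m)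
  (Hloop : forall p, self_loops (arc p) m)
  (tauD lambda : R) (HtauD : tauD > 0) (Hlambda : lambda > 0) :
  exists K : nat -> mat, exists g0 : R, g0 > 0 /\
    forall g : R, g >= g0 ->
      exists c : R, c > 0 /\
        forall (sigma : R -> P) (x : R -> vec) (xs : nat -> R -> vec),
          dwell_signal tauD sigma ->
          solves n x (fun _ v => mv n A v) ->
          (forall i, (i < m)%nat ->
             solves n (xs i)
               (fun t v => observer_rhs n m s A C K Pm g arc (sigma t) i
                             (fun j => if Nat.eqb j i then v else xs j t)
                             (mv n (C i) (x t)))) ->
          forall t, 0 <= t ->
            err_norm n m (fun i => xs i t) (x t)
              <= c * exp (- lambda * t) * err_norm n m (fun i => xs i 0) (x 0).
Proof.
  destruct (consensus_weights_uniform n m s A C Pm Hm Hobs HPm P Plist arc Hsc Hloop)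
    as [b [Hb Hpi]].
  (* The excess of 2 mu over 2 lambda is the rate at which [exp_ge_of_dwell] compensates one factor
     b^2 per dwell time. *)
  set (mu := lambda + (b ^ 2) ^ 2 / tauD / 2).
  assert (Hmu : 0 < mu).
  { assert (0 < (b ^ 2) ^ 2 / tauD).
    { apply Rdiv_lt_0_compat; [|lra]. apply pow_lt, pow_lt. lra. }
    unfold mu; lra. }
  destruct (observer_gains_exist n m s A C Pm HPm (mu + 1)) as [K [Q [d [Hd HK]]]].
  assert (Hb2 : 0 < b ^ 2) by (apply pow_lt; lra).
  exists K, (b ^ 2 * (1 + d + 2 * mu)). split.
  { apply Rmult_lt_0_compat; lra. }
  intros g Hg. apply Rge_le in Hg.
  set (kappa := kappa_of m d b g).
  set (c2 := (b + kappa * d) / Rmin (/ b) (kappa / d)).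
  assert (Hc2 : 0 < c2).
  { assert (0 <= g).
    { eapply Rle_trans; [|exact Hg]. apply Rmult_le_pos; lra. }
    assert (0 < kappa) by (apply kappa_pos; auto).
    assert (0 < kappa * d) by (apply Rmult_lt_0_compat; lra).
    apply Rdiv_lt_0_compat; [lra|].
    apply Rmin_glb_lt; [apply Rinv_0_lt_compat; lra|apply Rdiv_lt_0_compat; lra]. }
  (* The decay was obtained for the squared norm at rate 2 lambda; the square root turns it into the
     claim. *)
  exists (sqrt c2). split; [now apply sqrt_lt_R0|].
  intros sigma x xs Hdwell Hx Hxs t Ht.
  assert (En : forall t, err_norm n m (fun i => xs i t) (x t) =
    sqrt (sumR m (fun i => nsq n (vsub (xs i t) (x t))))).
  { intros u. unfold err_norm. f_equal. apply sumR_ext; intros i _.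
    apply sumR_ext; intros k _. unfold vsub. ring. }
  rewrite !En.
  replace (exp (- lambda * t)) with (sqrt (exp (- (2 * lambda) * t))).
  2: { replace (- (2 * lambda) * t) with (- lambda * t + - lambda * t) by ring.
       rewrite exp_plus. apply sqrt_square. left; apply exp_pos. }
  rewrite <- !sqrt_mult_alt.
  - apply sqrt_le_1_alt.
    apply (error_decay n m s A C Pm HPm mu K Q d Hmu Hd HK b Hb P arc sigma
      (fun i t => vsub (xs i t) (x t)) g lambda tauD); auto.
    + unfold mu. field. lra.
    + now apply (observer_error_deriv n m s A C Pm K g P arc sigma x xs).
  - apply Rmult_le_pos; [lra|left; apply exp_pos].
  - lra.
Qed.
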